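(* Let $g_1,g_2:(0,1)\to\mathbb{R}$ be left-continuous functions, each of whose sets of discontinuity points is a discrete set. Then the map $\rho_{g_1,g_2}$ on the set $\mathcal C_2$ of bivariate copulas, given by $\rho_{g_1,g_2}(C)=\rho(g_1(U),g_2(V))$ with $(U,V)\sim C$, is a measure of concordance if and only if there exists a concordance-inducing distribution function $G\in\mathcal G$ such that $\rho_{g_1,g_2}=\rho_{G^{-1}}$, i.e. $\rho(g_1(U),g_2(V))=\rho(G^{-1}(U),G^{-1}(V))$ for every $C\in\mathcal C_2$ and $(U,V)\sim C$.
   Context: A (bivariate) copula is a distribution function $C:[0,1]^2\to[0,1]$ with standard uniform univariate margins; $\mathcal C_2$ is the set of all bivariate copulas. $(U,V)\sim C$ means that $(U,V)$ is a random vector with distribution function $C$. For $C,C'\in\mathcal C_2$, $C\preceq C'$ means $C(u,v)\le C'(u,v)$ for all $(u,v)\in[0,1]^2$. $M(u,v)=\min(u,v)$ is the comonotonicity copula. For a map $\kappa:\mathcal C_2\to\mathbb R$ write $\kappa(U,V)$ for $\kappa(C)$ when $(U,V)\sim C$. A map $\kappa:\mathcal C_2\to\mathbb R$ is a measure of concordance if: (1) $\kappa(M)=1$; (2) $\kappa(V,U)=\kappa(U,V)$ for any $(U,V)\sim C\in\mathcal C_2$; (3) $\kappa(U,1-V)=-\kappa(U,V)$ for any $(U,V)\sim C\in\mathcal C_2$; (4) $\kappa(C)\le\kappa(C')$ whenever $C\preceq C'$; (5) $\kappa(C_n)\to\kappa(C)$ whenever $C_n\to C$ pointwise, $C_n,C\in\mathcal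 C_2$. $\rho(X,Y)=\mathrm{Cov}(X,Y)/(\sqrt{\mathrm{Var}(X)}\sqrt{\mathrm{Var}(Y)})$ is Pearson's correlation coefficient, defined when $X,Y$ have finite and strictly positive variances; saying that $\rho_{g_1,g_2}$ is a measure of concordance, or that it equals $\rho_{G^{-1}}$, includes that it is well defined, i.e. that $g_1(U)$ and $g_2(U)$ have finite and strictly positive variance for $U$ uniform on $(0,1)$. For a distribution function $G:\mathbb R\to[0,1]$, the quantile function is $G^{-1}(p)=\inf\{x\in\mathbb R: G(x)\ge p\}$, $p\in(0,1)$. $G$ is concordance-inducing if it is nondegenerate, has a finite second moment, and is symmetric, meaning $X-\mathbb E[X]$ and $\mathbb E[X]-X$ have the same distribution for $X\sim G$. $\mathcal G$ is the set of all concordance-inducing distribution functions. For $g:(0,1)\to\mathbb R$, $\rho_g:=\rho_{g,g}$. *)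

(* Defs.v *)
From HB Require Import structures.
From mathcomp Require Import all_boot all_order all_algebra.
From mathcomp Require Import interval_inference.
From mathcomp Require Import all_classical all_reals all_analysis.
From mathcomp Require Import measurable_realfun.

Set Implicit Arguments.
Unset Strict Implicit.
Unset Printing Implicit Defensive.

Import Order.TTheory GRing.Theory Num.Theory.
Import numFieldNormedType.Exports.

Local Open Scope classical_set_scope.
Local Open Scope ring_scope.

(* A copula is a function on the closed unit square; the distribution function
   of a random vector whose margins are uniform is determined by its values
   there. *)
Definition joint_df (R : realType) d (T : measurableType d)
    (P : probability T R) (U V : T -> R)
    (C : {i01 R} -> {i01 R} -> {i01 R}) : Prop :=
  [/\ measurable_fun setT U, measurable_fun setT V &
      forall u v : {i01 R},
        P [set t | U t <= u%:num /\ V t <= v%:num] = ((C u v)%:num)%:E].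

(* The margin conditions say that the margins of the underlying law are uniform
   on [0, 1]: with u = 1 and u = 0 they force the law onto the unit square. *)
Record copula (R : realType) := Copula {
  copula_fun :> {i01 R} -> {i01 R} -> {i01 R} ;
  copula_df : exists mu : probability (R * R)%type R,
    joint_df mu fst snd copula_fun ;
  copula_margin1 : forall u, copula_fun u 1%:i01 = u ;
  copula_margin2 : forall v, copula_fun 1%:i01 v = v }.

(* The law is unique: see joint_df_law below. *)
Definition law (R : realType) (C : copula R) : probability (R * R)%type R :=
  sval (cid (copula_df C)).

Definition pearson (R : realType) d (T : measurableType d)
    (P : probability T R) (X Y : T -> R) : R :=
  fine (covariance P X Y) /
    (Num.sqrt (fine ('V_P[X])) * Num.sqrt (fine ('V_P[Y]))).

(* The library's variance is only meaningful when the mean exists, hence the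
   integrability condition. *)
Definition fin_pos_variance (R : realType) d (T : measurableType d)
    (P : probability T R) (X : T -> R) : Prop :=
  X \in Lfun P 1 /\ (0 < 'V_P[X] < +oo)%E.

(* Functions on the open interval ]0, 1[ are represented by functions on R whose
   values elsewhere are ignored: they are replaced by 0, so that composing with
   an almost surely ]0, 1[-valued variable only depends on g on ]0, 1[. *)
Definition on01 (R : realType) (g : R -> R) : R -> R := g \_ `]0, 1[.

Definition rho_defined (R : realType) (g1 g2 : R -> R) : Prop :=
  fin_pos_variance (uniform_prob (@ltr01 R)) (on01 g1) /\
  fin_pos_variance (uniform_prob (@ltr01 R)) (on01 g2).

(* The value is the same for every random vector with distribution function C:
   see rhoE below. *)
Definition rho (R : realType) (g1 g2 : R -> R) (C : copula R) : R :=
  pearson (law C) (on01 g1 \o fst) (on01 g2 \o snd).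

Section joint_df_clamp.
Context (R : realType) d (T : measurableType d) (P : probability T R).
Variables (U V : T -> R) (C : copula R).
Hypothesis UVC : joint_df P U V C.

Let preim_le (f : T -> R) a :
  measurable_fun setT f -> measurable [set t | f t <= a].
Proof.
move=> mf; rewrite (_ : [set t | _] = setT `&` f @^-1` `]-oo, a]).
  exact: mf.
by apply/seteqP; split => t /=; rewrite in_itv//= => -[].
Qed.

Let mle a b : measurable [set t | U t <= a /\ V t <= b].
Proof. by have [mU mV _] := UVC; apply: measurableI; exact: preim_le. Qed.

Let clamp_ge0 (a : R) : 0 <= Num.max 0 (Num.min a 1).
Proof. by rewrite le_max lexx. Qed.

Let clamp_le1 (a : R) : Num.max 0 (Num.min a 1) <= 1.
Proof. by rewrite ge_max ler01/= ge_min lexx orbT. Qed.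

Let clamp (a : R) : {i01 R} := Itv01 (clamp_ge0 a) (clamp_le1 a).

Let out : set T := ~` [set t | U t <= 1 /\ V t <= 1] `|`
  ([set t | U t <= 0 /\ V t <= 1] `|` [set t | U t <= 1 /\ V t <= 0]).

Let out_measurable : measurable out.
Proof.
by apply: measurableU; [exact: measurableC|exact: measurableU].
Qed.


Let P_out : P out = 0%E.
Proof.
have [_ _ df] := UVC.
apply: null_set_setU => //; try exact: measurableC; try exact: measurableU.
  have df1 : P [set t | U t <= 1 /\ V t <= 1] = 1%E.
    by rewrite (df 1%:i01 1%:i01) copula_margin1.
  by rewrite [LHS](probability_setC P)// [X in (1 - X)%E]df1 subee.
apply: null_set_setU => //.
  by rewrite [LHS](df 0%:i01 1%:i01) copula_margin1.
by rewrite [LHS](df 1%:i01 0%:i01) copula_margin2.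
Qed.

Let out_clampE t : ~ out t -> forall a b,
  (U t <= a /\ V t <= b) <->
  (U t <= (clamp a)%:num /\ V t <= (clamp b)%:num).
Proof.
move=> Nt a b; have h1 : U t <= 1 /\ V t <= 1.
  by apply: contrapT => h; apply: Nt; left.
have U0 : 0 < U t.
  by rewrite ltNge; apply/negP => h; apply: Nt; right; left; case: h1.
have V0 : 0 < V t.
  by rewrite ltNge; apply/negP => h; apply: Nt; right; right; case: h1.
case: h1 => U1 V1.
have {}U0 : (U t <= 0) = false by rewrite leNgt U0.
have {}V0 : (V t <= 0) = false by rewrite leNgt V0.
by rewrite /= !le_max !le_min U1 V1 !andbT U0 V0.
Qed.

Lemma joint_df_clamp a b :
  P [set t | U t <= a /\ V t <= b] = ((C (clamp a) (clamp b))%:num)%:E.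
Proof.
have [_ _ <-] := UVC.
have key A : measurable A -> P A = P (A `\` out).
  move=> mA; rewrite [LHS](measureDI P mA out_measurable).
  rewrite [X in (_ + X)%E](_ : _ = 0%E) ?adde0//.
  apply/eqP; rewrite -measure_le0 -P_out le_measure ?inE//.
  exact: measurableI.
rewrite [LHS]key// [RHS]key//; congr (P _).
by apply/seteqP; split=> t [/= h Nt]; split => //; case: (out_clampE Nt a b); auto.
Qed.

End joint_df_clamp.

Section law_unique.
Context (R : realType) d (T : measurableType d) (P : probability T R).
Variables (U V : T -> R) (C : copula R).
Hypothesis UVC : joint_df P U V C.

Let rays : set (set (R * R)) :=
  [set A | exists a b : R, A = [set x | x.1 <= a /\ x.2 <= b]].

Let measurable_fst_rays :
  measurable_fun setT (fst : g_sigma_algebraType rays -> R).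
Proof.
apply: (measurability (@RGenOInfty.G R)) => [|_ [_] [r] -> <-].
  exact: RGenOInfty.measurableE.
rewrite setTI -[X in measurable X]setCK; apply: measurableC.
rewrite (_ : ~` _ = \bigcup_n [set x : R * R | x.1 <= r /\ x.2 <= n%:R]).
  apply: bigcupT_measurable => n; apply: sub_sigma_algebra.
  by exists r, n%:R.
apply/seteqP; split => [[x y]/=|[x y] [n _ /= [xr _]]]; last first.
  by rewrite in_itv/= andbT; apply/negP; rewrite -leNgt.
rewrite in_itv/= andbT => /negP; rewrite -leNgt => xr.
exists (Num.bound `|y|) => //=; split => //.
by rewrite (le_trans (ler_norm y))// ltW// archi_boundP.
Qed.

Let measurable_snd_rays :
  measurable_fun setT (snd : g_sigma_algebraType rays -> R).
Proof.
apply: (measurability (@RGenOInfty.G R)) => [|_ [_] [r] -> <-].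
  exact: RGenOInfty.measurableE.
rewrite setTI -[X in measurable X]setCK; apply: measurableC.
rewrite (_ : ~` _ = \bigcup_n [set x : R * R | x.1 <= n%:R /\ x.2 <= r]).
  apply: bigcupT_measurable => n; apply: sub_sigma_algebra.
  by exists n%:R, r.
apply/seteqP; split => [[x y]/=|[x y] [n _ /= [_ xr]]]; last first.
  by rewrite in_itv/= andbT; apply/negP; rewrite -leNgt.
rewrite in_itv/= andbT => /negP; rewrite -leNgt => xr.
exists (Num.bound `|x|) => //=; split => //.
by rewrite (le_trans (ler_norm x))// ltW// archi_boundP.
Qed.

Let measurable_rays (a b : R) :
  measurable [set x : R * R | x.1 <= a /\ x.2 <= b].
Proof.
rewrite (_ : [set _ | _] = `]-oo, a] `*` `]-oo, b]).
  exact: measurableX.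
by apply/seteqP; split => -[x y] /=; rewrite !in_itv.
Qed.

Lemma joint_df_law A : measurable A ->
  P ((fun t => (U t, V t)) @^-1` A) = law C A.
Proof.
move=> mA; have [mU mV _] := UVC.
have mUV : measurable_fun setT (fun t => (U t, V t)).
  exact: measurable_fun_pair.
pose UV : {mfun T >-> (R * R)%type} :=
  HB.pack (fun t => (U t, V t)) (isMeasurableFun.Build _ _ _ _ _ mUV).
change (distribution P UV A = law C A).
have lawC : joint_df (law C) fst snd C by rewrite /law; case: cid.
apply: (measure_unique rays (fun n => [set x | x.1 <= n%:R /\ x.2 <= n%:R])) => //.
- apply/seteqP; split.
    rewrite measurable_prod_measurableType.
    apply: smallest_sub; first exact: smallest_sigma_algebra.
    move=> _ [B mB [D mD <-]].
    have -> : B `*` D = (setT `&` fst @^-1` B) `&` (setT `&` snd @^-1` D).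
      by apply/seteqP; split => -[x y] /=; tauto.
    apply: (@measurableI _ (g_sigma_algebraType rays)).
      exact: measurable_fst_rays.
    exact: measurable_snd_rays.
  apply: smallest_sub; first exact: sigma_algebra_measurable.
  by move=> _ [a [b ->]]; exact: measurable_rays.
- move=> _ _ [a [b ->]] [a' [b' ->]]; exists (Num.min a a'), (Num.min b b').
  apply/seteqP; split => -[x y] /=; rewrite !le_min.
    by move=> [[-> ->] [-> ->]].
  by move=> [/andP[-> ->] /andP[-> ->]].
- by move=> n; exists n%:R, n%:R.
- apply/seteqP; split => // -[x y] _.
  exists (Num.bound (Num.max `|x| `|y|)) => //=.
  have h : Num.max `|x| `|y| < (Num.bound (Num.max `|x| `|y|))%:R.
    by rewrite archi_boundP// le_max normr_ge0.
  split.
    by rewrite (le_trans _ (ltW h))// le_max ler_norm.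
  by rewrite (le_trans _ (ltW h))// le_max ler_norm orbT.
- move=> _ [a [b ->]].
  rewrite /= /distribution /pushforward /=.
  by rewrite (joint_df_clamp lawC) -(joint_df_clamp UVC).
- by move=> n; rewrite (le_lt_trans (probability_le1 _ _)) ?ltry.
Qed.

Let expectation_law (f : R * R -> R) : measurable_fun setT f ->
  ('E_P[fun t => f (U t, V t)] = 'E_(law C)[f])%E.
Proof.
move=> mf; have [mU mV _] := UVC.
have mUV : measurable_fun setT (fun t => (U t, V t)).
  exact: measurable_fun_pair.
pose UV : {mfun T >-> (R * R)%type} :=
  HB.pack (fun t => (U t, V t)) (isMeasurableFun.Build _ _ _ _ _ mUV).
rewrite unlock.
have mEf : measurable_fun setT (EFin \o f) by exact/measurable_EFinP.
have ge0E (h : R * R -> \bar R) : measurable_fun setT h ->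
    (forall x, 0 <= h x)%E ->
    (\int[P]_t h (U t, V t) = \int[law C]_x h x)%E.
  move=> mh h0.
  transitivity (\int[distribution P UV]_x h x)%E.
    by rewrite ge0_integral_distribution.
  by apply: eq_measure_integral => A mA _; exact: joint_df_law.
rewrite integralE [RHS]integralE.
rewrite -[X in _ = (X - _)%E]ge0E//; last exact: measurable_funepos.
rewrite -[X in _ = (_ - X)%E]ge0E//; last exact: measurable_funeneg.
by congr (_ - _)%E; apply: eq_integral => t _; rewrite !(funeposE, funenegE).
Qed.

Lemma rhoE g1 g2 : rho_defined g1 g2 ->
  pearson P (on01 g1 \o U) (on01 g2 \o V) = rho g1 g2 C.
Proof.
move=> [[/sub_Lfun_mfun mg1 _] [/sub_Lfun_mfun mg2 _]].
have {}mg1 : measurable_fun setT (on01 g1) by move: mg1; rewrite inE.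
have {}mg2 : measurable_fun setT (on01 g2) by move: mg2; rewrite inE.
have m1 : measurable_fun setT (on01 g1 \o (fst : R * R -> R)).
  exact: measurableT_comp.
have m2 : measurable_fun setT (on01 g2 \o (snd : R * R -> R)).
  exact: measurableT_comp.
have cov f g : measurable_fun setT f -> measurable_fun setT g ->
    covariance P (fun t => f (U t, V t)) (fun t => g (U t, V t)) =
    covariance (law C) f g.
  move=> mf mg; rewrite unlock -!expectation_law//.
  by apply: measurable_funM; apply: measurable_funB.
rewrite /rho /pearson /variance.
by rewrite -(cov _ _ m1 m2) -(cov _ _ m1 m1) -(cov _ _ m2 m2).
Qed.

End law_unique.

Section comonotone.
Context (R : realType).

Definition comonotonicity_fun (u v : {i01 R}) : {i01 R} := Num.min u v.

Fact comonotonicity_df : exists mu : probability (R * R)%type R, joint_df mu fst snd comonotonicity_fun.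
Proof.
have mD : measurable_fun setT (fun x : measurableTypeR R => (x : R, x : R)).
  exact: measurable_fun_pair.
pose D : {mfun (measurableTypeR R) >-> (R * R)%type} :=
  HB.pack (fun x : measurableTypeR R => (x : R, x : R))
    (isMeasurableFun.Build _ _ _ _ _ mD).
exists (distribution (uniform_prob (@ltr01 R)) D); split => //.
move=> u v; rewrite /distribution /pushforward /=.
rewrite /uniform_prob integral_uniform_pdf.
have m0 : 0 <= (comonotonicity_fun u v)%:num by exact: ge0.
have m1 : (comonotonicity_fun u v)%:num <= 1 by exact: le1.
set m := (comonotonicity_fun u v)%:num in m0 m1 *.
have mE : m = Num.min u%:num v%:num.
  by rewrite /m /comonotonicity_fun !minEle -num_le; case: ifP.
rewrite (_ : _ `&` _ = `[0, m]%classic); last first.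
  apply/seteqP; split => x /=; rewrite !in_itv/= mE le_min.
    by move=> [[-> ->] /andP[-> _]].
  move=> /and3P[-> xu xv]; split=> //=.
  exact: (le_trans xu (le1 _)).
rewrite (eq_integral (fun=> 1%E)); last first.
  move=> x; rewrite inE/= in_itv/= => /andP[x0 xm].
  by rewrite /uniform_pdf x0 (le_trans xm m1)/= subr0 invr1.
rewrite integral_cst//= mul1e lebesgue_measure_itv/= lte_fin sube0.
by case: ltP => // h; congr (_%:E); apply/eqP; rewrite eq_le m0 h.
Qed.

Fact comonotonicity_margin1 u : comonotonicity_fun u 1%:i01 = u.
Proof. by apply/min_idPl; rewrite -num_le/=; exact: le1. Qed.

Fact comonotonicity_margin2 v : comonotonicity_fun 1%:i01 v = v.
Proof. by apply/min_idPr; rewrite -num_le/=; exact: le1. Qed.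

Definition comonotonicity : copula R :=
  Copula comonotonicity_df comonotonicity_margin1 comonotonicity_margin2.

End comonotone.

Definition measure_of_concordance (R : realType) (kappa : copula R -> R) :=
  [/\ kappa (comonotonicity R) = 1,
      forall d (T : measurableType d) (P : probability T R) (U V : T -> R)
        (C C' : copula R),
        joint_df P U V C -> joint_df P V U C' -> kappa C' = kappa C,
      forall d (T : measurableType d) (P : probability T R) (U V : T -> R)
        (C C' : copula R),
        joint_df P U V C -> joint_df P U (fun t => 1 - V t) C' ->
        kappa C' = - kappa C,
      forall C C' : copula R,
        (forall u v, (C u v)%:num <= (C' u v)%:num) -> kappa C <= kappa C' &
      forall (C_ : nat -> copula R) (C : copula R),
        (forall u v, (C_ n u v)%:num @[n --> \oo] --> (C u v)%:num) ->
        kappa (C_ n) @[n --> \oo] --> kappa C].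

Definition quantile (R : realType) (G : R -> R) (p : R) : R :=
  inf [set x | p <= G x].

(* An element of [cumulativeBounded 0 1] is a distribution function on R, and
   its Lebesgue-Stieltjes measure mu is the law of X ~ G. *)
Definition concordance_inducing (R : realType)
    (G : cumulativeBounded (0 : R) (1 : R)) : Prop :=
  let mu := lebesgue_stieltjes_measure G in
  let m : R := fine ('E_mu[(fun x : R => x)])%E in
  [/\ forall c : R, mu [set c] != 1%E,
      ('E_mu[(fun x : R => x ^+ 2)%R] < +oo)%E &
      forall A : set R, measurable A ->
        mu [set x | A (x - m)] = mu [set x | A (m - x)]].

Definition left_continuous01 (R : realType) (g : R -> R) : Prop :=
  forall x, 0 < x < 1 -> g @ x^'- --> g x.

Definition discontinuities01 (R : realType) (g : R -> R) : set R :=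
  [set x | 0 < x < 1 /\ ~ {for x, continuous g}].

(* Every point is isolated, i.e. the subspace topology is discrete. *)
Definition discrete_set (T : topologicalType) (D : set T) : Prop :=
  D `<=` isolated D.

(* Main.v *)
From HB Require Import structures.
Require Import Defs.
From mathcomp Require Import all_boot all_order all_algebra.
From mathcomp Require Import interval_inference.
From mathcomp Require Import all_classical all_reals all_analysis.
From mathcomp Require Import measurable_realfun lra ring.

Set Implicit Arguments.
Unset Strict Implicit.
Unset Printing Implicit Defensive.

Import Order.TTheory GRing.Theory Num.Theory.
Import numFieldNormedType.Exports.

Local Open Scope classical_set_scope.
Local Open Scope ring_scope.

(** Necessity. Comparing rho at the comonotonicity copula with 1 is the
equality case of Cauchy-Schwarz, so g2 is almost everywhere an increasing
affine function of g1 and rho g1 g2 = rho g1 g1. For a < b < c let s (resp. t)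
exchange by translation the left neighbourhoods of length h of a and b (resp.
of a and c). The copula of (U, t U) lies below that of (s U, t U), and since s
is an involution the difference of the two covariances of g1 is half the mean
of (g1 (s U) - g1 U) (g1 (t U) - g1 (t (s U))). This integrand vanishes off the
two neighbourhoods exchanged by s, and on them it is close to (g1 b - g1 a) (g1
c - g1 b) for small h, by left continuity. Coherence thus makes this product
nonnegative for all a < b < c, that is g1 is monotone; up to sign it is
nondecreasing, hence the quantile function of the law of g1 U. This law is
symmetric because rho = -1 at the copula of (U, 1 - U).

Sufficiency. A square integrable quantile function q is an L^2 limit of
nonnegative combinations of indicators of rays. The covariance of two such
steps is, up to a constant, a nonnegative combination of the values of the
copula, and it converges to the covariance of q U and q V uniformly in the
copula, by Cauchy-Schwarz: monotonicity and continuity in the copula follow.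
Antisymmetry holds since q (1 - U) and 2 m - q U agree almost surely: two
nondecreasing functions of U with the same law are almost surely equal. *)

(** * Square integrable random variables *)

Section moments.
Context d (T : measurableType d) (R : realType) (P : probability T R).
Implicit Types X Y : T -> R.

Lemma Lfun_measurable p X : X \in Lfun P p -> measurable_fun setT X.
Proof. by move=> /sub_Lfun_mfun XP; move: XP; rewrite inE. Qed.

Lemma Lfun2P X : X \in Lfun P 2%:E <->
  measurable_fun setT X /\ (\int[P]_t (X t ^+ 2)%:E < +oo)%E.
Proof.
split=> [X2|[mX X2]].
  split; first exact: Lfun_measurable X2.
  exact: (integrable_lty measurableT (Lfun2_integrable_sqr X2)).
rewrite inE; apply/andP; split; rewrite inE//=.
rewrite /finite_norm unlock /=; apply: poweR_lty.
under eq_integral => t _.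
  rewrite /= powR_mulrn// -normrX ger0_norm ?sqr_ge0//.
  over.
exact: X2.
Qed.

Lemma Lfun2_Lfun1 X : X \in Lfun P 2%:E -> X \in Lfun P 1.
Proof. by apply/Lfun_subset12/fin_num_measure. Qed.

Lemma Lfun2D X Y : X \in Lfun P 2%:E -> Y \in Lfun P 2%:E ->
  X \+ Y \in Lfun P 2%:E.
Proof. by move=> X2 Y2; apply: rpredD => //; rewrite lee1n. Qed.

Lemma Lfun2N X : X \in Lfun P 2%:E -> \- X \in Lfun P 2%:E.
Proof. by move=> X2; rewrite rpredN. Qed.

Lemma Lfun2B X Y : X \in Lfun P 2%:E -> Y \in Lfun P 2%:E ->
  X \- Y \in Lfun P 2%:E.
Proof. by move=> X2 Y2; apply: Lfun2D => //; apply: Lfun2N. Qed.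

Lemma Lfun2Z a X : X \in Lfun P 2%:E -> a \o* X \in Lfun P 2%:E.
Proof. by move=> X2; apply: Lfun_scale => //; rewrite ler1n. Qed.

Lemma Lfun2_bounded X M : measurable_fun setT X -> (forall t, `|X t| <= M) ->
  X \in Lfun P 2%:E.
Proof.
move=> mX XM; apply/Lfun2P; split => //.
apply: (@le_lt_trans _ _ (\int[P]_t (M ^+ 2)%:E)%E).
  apply: ge0_le_integral => //.
  - by move=> t _; rewrite lee_fin sqr_ge0.
  - by apply/measurable_EFinP; apply: measurable_funX.
  - move=> t _; rewrite lee_fin -[X t ^+ 2]ger0_norm ?sqr_ge0// normrX.
    by rewrite lerXn2r// nnegrE (le_trans _ (XM t)).
by rewrite integral_cst//= probability_setT mule1 ltry.
Qed.

(** Centering [X] gives a variable whose second moment is the finite variance; adding the constant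
    mean back stays in L^2. *)
Lemma fin_pos_variance_Lfun2 X : fin_pos_variance P X -> X \in Lfun P 2%:E.
Proof.
move=> [X1 /andP[_ VX]].
have mX := Lfun_measurable X1.
have -> : X = (X \- cst (fine 'E_P[X])%E) \+ cst (fine 'E_P[X])%E.
  by apply/funext => t /=; rewrite subrK.
apply: Lfun2D; last exact: Lfun_cst.
apply/Lfun2P; split; first by apply: measurable_funB.
move: VX; rewrite /variance covariance.unlock; set m := fine _.
by rewrite unlock.
Qed.

Lemma expectation_ae X Y : measurable_fun setT X -> measurable_fun setT Y ->
  {ae P, forall t, X t = Y t} -> 'E_P[X]%E = 'E_P[Y]%E.
Proof.
move=> mX mY XY; rewrite unlock; apply: ae_eq_integral => //.
- exact/measurable_EFinP.
- exact/measurable_EFinP.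
- by apply: filterS XY => t -> _.
Qed.

Lemma covariance_ae X X' Y Y' :
  measurable_fun setT X -> measurable_fun setT X' ->
  measurable_fun setT Y -> measurable_fun setT Y' ->
  {ae P, forall t, X t = X' t} -> {ae P, forall t, Y t = Y' t} ->
  covariance P X Y = covariance P X' Y'.
Proof.
move=> mX mX' mY mY' XX' YY'.
rewrite unlock (expectation_ae mX mX' XX') (expectation_ae mY mY' YY').
apply: expectation_ae.
- by apply: measurable_funM; apply: measurable_funB.
- by apply: measurable_funM; apply: measurable_funB.
- by apply: filterS2 XX' YY' => t Xt Yt; rewrite !fctE /= Xt Yt.
Qed.

(** The variance integrates a nonnegative square, so a zero integral makes the square vanish almost
    everywhere. *)
Lemma variance0_ae X : X \in Lfun P 2%:E -> 'V_P[X] = 0%E ->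
  {ae P, forall t, X t = fine 'E_P[X]%E}.
Proof.
move=> X2 V0; have mX := Lfun_measurable X2.
pose Y t := ((X t - fine 'E_P[X]%E) ^+ 2)%:E.
have mY : measurable_fun setT Y.
  by apply/measurable_EFinP; apply: measurable_funX; apply: measurable_funB.
have : (\int[P]_t `|Y t| = 0)%E.
  rewrite -[RHS]V0 /variance covariance.unlock /Y; set m := fine _.
  rewrite unlock.
  by apply: eq_integral => t _; rewrite gee0_abs// lee_fin sqr_ge0.
move/(ae_eq_integral_abs P measurableT mY).
apply: filterS => t /(_ Logic.I) [] /eqP; rewrite sqrf_eq0 subr_eq0.
by move/eqP.
Qed.

(** Taking [fine] turns bilinearity into equations in [R], open to ring and linear arithmetic; by
    [cov_finE] nothing is lost on square integrable variables. *)
Definition cov X Y : R := fine (covariance P X Y).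

Lemma cov_finE X Y : X \in Lfun P 2%:E -> Y \in Lfun P 2%:E ->
  covariance P X Y = (cov X Y)%:E.
Proof.
move=> X2 Y2; rewrite fineK//; apply: covariance_fin_num.
- exact: Lfun2_Lfun1.
- exact: Lfun2_Lfun1.
- exact: Lfun2_mul_Lfun1.
Qed.

Lemma covC X Y : cov X Y = cov Y X.
Proof. by rewrite /cov covarianceC. Qed.

Lemma cov_ge0 X : 0 <= cov X X.
Proof. by rewrite fine_ge0// variance_ge0. Qed.

Lemma covDl X Y Z : X \in Lfun P 2%:E -> Y \in Lfun P 2%:E ->
  Z \in Lfun P 2%:E -> cov (X \+ Y) Z = cov X Z + cov Y Z.
Proof.
by move=> X2 Y2 Z2; rewrite /cov covarianceDl// !cov_finE.
Qed.

Lemma covBl X Y Z : X \in Lfun P 2%:E -> Y \in Lfun P 2%:E ->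
  Z \in Lfun P 2%:E -> cov (X \- Y) Z = cov X Z - cov Y Z.
Proof.
by move=> X2 Y2 Z2; rewrite /cov covarianceBl// !cov_finE.
Qed.

Lemma covZl a X Z : X \in Lfun P 2%:E -> Z \in Lfun P 2%:E ->
  cov (a \o* X) Z = a * cov X Z.
Proof.
move=> X2 Z2; rewrite /cov covarianceZl ?cov_finE//.
- exact: Lfun2_Lfun1.
- exact: Lfun2_Lfun1.
- exact: Lfun2_mul_Lfun1.
Qed.

Lemma cov_cstl a X : cov (cst a) X = 0.
Proof. by rewrite /cov covariance_cst_l. Qed.

Lemma covDr X Y Z : X \in Lfun P 2%:E -> Y \in Lfun P 2%:E ->
  Z \in Lfun P 2%:E -> cov Z (X \+ Y) = cov Z X + cov Z Y.
Proof. by move=> X2 Y2 Z2; rewrite !(covC Z) covDl. Qed.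

Lemma covBr X Y Z : X \in Lfun P 2%:E -> Y \in Lfun P 2%:E ->
  Z \in Lfun P 2%:E -> cov Z (X \- Y) = cov Z X - cov Z Y.
Proof. by move=> X2 Y2 Z2; rewrite !(covC Z) covBl. Qed.

Lemma covZr a X Z : X \in Lfun P 2%:E -> Z \in Lfun P 2%:E ->
  cov Z (a \o* X) = a * cov Z X.
Proof. by move=> X2 Z2; rewrite !(covC Z) covZl. Qed.

Lemma cov_cstr a X : cov X (cst a) = 0.
Proof. by rewrite covC cov_cstl. Qed.

Lemma covNl X Z : X \in Lfun P 2%:E -> Z \in Lfun P 2%:E ->
  cov (\- X) Z = - cov X Z.
Proof.
move=> X2 Z2; rewrite -[RHS]mulN1r -covZl//; congr cov.
by apply/funext => t /=; rewrite mulrN1.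
Qed.

Lemma cov_affine a b X Z : X \in Lfun P 2%:E -> Z \in Lfun P 2%:E ->
  cov Z (a \o* X \+ cst b) = a * cov Z X.
Proof.
move=> X2 Z2; rewrite covDr ?Lfun2Z ?Lfun_cst// covZr// cov_cstr addr0.
by [].
Qed.

(** Cauchy-Schwarz: the one-sided bound [covariance_le] is applied to [X] and to its opposite. *)
Lemma cov_le X Y : X \in Lfun P 2%:E -> Y \in Lfun P 2%:E ->
  `|cov X Y| <= Num.sqrt (cov X X) * Num.sqrt (cov Y Y).
Proof.
have le X' Y' : X' \in Lfun P 2%:E -> Y' \in Lfun P 2%:E ->
    cov X' Y' <= Num.sqrt (cov X' X') * Num.sqrt (cov Y' Y').
  move=> X2 Y2; have := covariance_le X2 Y2.
  rewrite /variance !cov_finE//.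
move=> X2 Y2; rewrite ler_norml le// andbT lerNl -covNl//.
apply: le_trans (le _ _ _ _) _ => //; first exact: Lfun2N.
by rewrite covNl ?Lfun2N// covC covNl// opprK.
Qed.

Lemma covE X Y : X \in Lfun P 2%:E -> Y \in Lfun P 2%:E ->
  cov X Y = fine 'E_P[X \* Y]%E - fine 'E_P[X]%E * fine 'E_P[Y]%E.
Proof.
move=> X2 Y2; have XY1 := Lfun2_mul_Lfun1 X2 Y2.
have X1 := Lfun2_Lfun1 X2; have Y1 := Lfun2_Lfun1 Y2.
rewrite /cov (covarianceE X1 Y1 XY1) -[(X * Y)%R]/(X \* Y).
by rewrite fineB ?fineM// ?fin_numM// expectation_fin_num.
Qed.

End moments.

Section ae.
Context d (T : measurableType d) (R : realType) (P : probability T R).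

Lemma ae_mono (A B : T -> Prop) : (forall t, A t -> B t) ->
  {ae P, forall t, A t} -> {ae P, forall t, B t}.
Proof. by move=> AB; apply: filterS. Qed.

Lemma ae_mono2 (A B C : T -> Prop) : (forall t, A t -> B t -> C t) ->
  {ae P, forall t, A t} -> {ae P, forall t, B t} -> {ae P, forall t, C t}.
Proof. by move=> ABC; apply: filterS2. Qed.

End ae.

(** * Laws of random variables and transport of moments *)

Definition has_law d d' (T : measurableType d) (T' : measurableType d')
    (R : realType) (P : probability T R) (Q : probability T' R) (X : T -> T') :=
  measurable_fun setT X /\ forall A, measurable A -> P (X @^-1` A) = Q A.

Section has_law.
Context d d' (T : measurableType d) (T' : measurableType d') (R : realType).
Context (P : probability T R) (X : T -> T') (Q : probability T' R).
Hypothesis XQ : has_law P Q X.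

Lemma has_law_ge0_integral (f : T' -> \bar R) : measurable_fun setT f ->
  (forall x, 0 <= f x)%E -> (\int[P]_t f (X t) = \int[Q]_x f x)%E.
Proof.
move=> mf f0; have [mX XQE] := XQ.
pose X' : {mfun T >-> T'} := HB.pack X (isMeasurableFun.Build _ _ _ _ _ mX).
transitivity (\int[distribution P X']_x f x)%E.
  by rewrite ge0_integral_distribution.
by apply: eq_measure_integral => A mA _; exact: XQE.
Qed.

(** Positive and negative parts are transported separately, so measurability of [f] is enough and no
    integrability has to be checked. *)
Lemma has_law_expectation (f : T' -> R) : measurable_fun setT f ->
  'E_P[f \o X]%E = 'E_Q[f]%E.
Proof.
move=> mf; rewrite unlock integralE [RHS]integralE.
have mEf : measurable_fun setT (EFin \o f) by exact/measurable_EFinP.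
rewrite -[X in _ = (X - _)%E]has_law_ge0_integral//; last first.
  exact: measurable_funepos.
rewrite -[X in _ = (_ - X)%E]has_law_ge0_integral//; last first.
  exact: measurable_funeneg.
by congr (_ - _)%E; apply: eq_integral => t _; rewrite !(funeposE, funenegE).
Qed.

Lemma has_law_Lfun2 (f : T' -> R) : f \in Lfun Q 2%:E ->
  f \o X \in Lfun P 2%:E.
Proof.
move=> /Lfun2P[mf f2]; apply/Lfun2P; split.
  by apply: measurableT_comp => //; case: XQ.
rewrite (has_law_ge0_integral (f := fun x => (f x ^+ 2)%:E))//.
- by apply/measurable_EFinP; apply: measurable_funX.
- by move=> x; rewrite lee_fin sqr_ge0.
Qed.

Lemma has_law_covariance (f g : T' -> R) : measurable_fun setT f ->
  measurable_fun setT g -> covariance P (f \o X) (g \o X) = covariance Q f g.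
Proof.
move=> mf mg; rewrite unlock !has_law_expectation// -[RHS]has_law_expectation//.
by apply: measurable_funM; apply: measurable_funB.
Qed.

Lemma has_law_ae (p : T' -> Prop) :
  {ae Q, forall x, p x} -> {ae P, forall t, p (X t)}.
Proof.
move=> [N [mN QN Np]]; have [mX XQE] := XQ; exists (X @^-1` N); split.
- by rewrite -[X in measurable X]setTI; exact: mX.
- by rewrite XQE.
- by move=> t /= pXt; exact: Np.
Qed.

End has_law.

Lemma has_law_comp d d' d'' (T : measurableType d) (T' : measurableType d')
    (T'' : measurableType d'') (R : realType) (P : probability T R)
    (Q : probability T' R) (S : probability T'' R) (X : T -> T')
    (Y : T' -> T'') :
  has_law P Q X -> has_law Q S Y -> has_law P S (Y \o X).
Proof.
move=> [mX XQ] [mY YS]; split; first exact: measurableT_comp.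
move=> A mA; rewrite comp_preimage XQ ?YS//.
by rewrite -[X in measurable X]setTI; exact: mY.
Qed.

(** * Uniform variables and copulas *)

Lemma measurable_preimage d d' (T : measurableType d) (T' : measurableType d')
    (f : T -> T') (A : set T') :
  measurable_fun setT f -> measurable A -> measurable (f @^-1` A).
Proof. by move=> mf mA; rewrite -[X in measurable X]setTI; exact: mf. Qed.

Lemma measurable_le d (T : measurableType d) (R : realType) (f : T -> R) a :
  measurable_fun setT f -> measurable [set t | f t <= a].
Proof.
move=> mf; have -> : [set t | f t <= a] = f @^-1` `]-oo, a]%classic.
  by apply/seteqP; split => t; rewrite /= in_itv.
exact: measurable_preimage.
Qed.

(** By complementation the two laws agree on the open rays to the right, which generate the Borel
    sets, are stable under intersection and contain a countable cover of the line. *)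
Lemma cdf_unique (R : realType) (Q Q' : probability (measurableTypeR R) R) :
  (forall a, Q [set x | x <= a] = Q' [set x | x <= a]) ->
  forall A, measurable A -> Q A = Q' A.
Proof.
move=> QQ' A mA.
apply: (@measure_unique _ R (measurableTypeR R) (@RGenOInfty.G R)
  (fun n => `]- n%:R, +oo[%classic)) => //.
- exact: RGenOInfty.measurableE.
- move=> _ _ [a ->] [b ->]; exists (Num.max a b).
  by apply/seteqP; split => x /=; rewrite !in_itv/= !andbT gt_max => /andP.
- by move=> n; exists (- n%:R).
- apply/seteqP; split => // x _; exists (Num.bound `|x|) => //=.
  rewrite in_itv/= andbT ltrNl.
  by rewrite (le_lt_trans (ler_norm _))// normrN archi_boundP.
- move=> _ [a ->]; have -> : `]a, +oo[%classic = ~` [set x : R | x <= a].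
    by apply/seteqP; split => x /=; rewrite in_itv/= andbT ltNge => /negP.
  rewrite ![_ (~` _)]probability_setC ?QQ'//; exact: measurable_le.
- by move=> n; rewrite (le_lt_trans (probability_le1 _ _)) ?ltry.
Qed.

Lemma has_law_cdf d (T : measurableType d) (R : realType) (P : probability T R)
    (X : T -> R) (Q : probability (measurableTypeR R) R) :
  measurable_fun setT X ->
  (forall a, P [set t | X t <= a] = Q [set x | x <= a]) -> has_law P Q X.
Proof.
move=> mX XQ; split => // A mA.
have mX' : measurable_fun setT (X : T -> measurableTypeR R) by exact: mX.
pose X' : {mfun T >-> measurableTypeR R} :=
  HB.pack (X : T -> measurableTypeR R) (isMeasurableFun.Build _ _ _ _ _ mX').
change (distribution P X' A = Q A).
by apply: cdf_unique => // a; rewrite -XQ.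
Qed.

Section uniform.
Context (R : realType).

Local Notation lam :=
  [the probability (measurableTypeR R) R of uniform_prob (@ltr01 R)].
Local Notation mu := (@lebesgue_measure R).

Lemma uniformE A : measurable A -> lam A = mu (A `&` `[0, 1]%classic).
Proof.
move=> mA; rewrite [LHS]integral_uniform_pdf.
rewrite (eq_integral (fun=> 1%E)); last first.
  move=> x; rewrite inE/= in_itv/= /uniform_pdf => -[_ ->].
  by rewrite subr0 invr1.
by rewrite integral_cst ?mul1e//; exact: measurableI.
Qed.

Lemma uniform_le a : 0 <= a <= 1 -> lam [set x | x <= a] = a%:E.
Proof.
move=> /andP[a0 a1]; rewrite uniformE; last exact: measurable_le.
have -> : [set x | x <= a] `&` `[0, 1]%classic = `[0, a]%classic.
  apply/seteqP; split => x /=; rewrite !in_itv/=.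
    by move=> [-> /andP[->]].
  by move=> /andP[-> xa]; rewrite xa (le_trans xa).
rewrite lebesgue_measure_itv/= lte_fin sube0.
by case: ltP => // h; congr (_%:E); apply/eqP; rewrite eq_le a0 h.
Qed.

(** The values 0 at 0 and 1 at 1 force the distribution function outside the unit interval, by
    monotonicity. *)
Lemma has_law_uniform d (T : measurableType d) (P : probability T R)
    (X : T -> R) : measurable_fun setT X ->
  (forall a, 0 <= a <= 1 -> P [set t | X t <= a] = a%:E) -> has_law P lam X.
Proof.
move=> mX XP; apply: has_law_cdf => // a.
(* Both distribution functions are the clamp of [a] to the unit interval; [F] is stated for an
   arbitrary variable so as to serve for [X] and for the identity under [lam]. *)
suff F (d' : measure_display) (T' : measurableType d') (Q : probability T' R)
    (Y : T' -> R) : measurable_fun setT Y ->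
    (forall a, 0 <= a <= 1 -> Q [set t | Y t <= a] = a%:E) ->
    Q [set t | Y t <= a] = (Num.max 0 (Num.min a 1))%:E.
  rewrite (F _ _ P X)// (F _ _ lam id)//.
  exact: uniform_le.
move=> mY YQ; have [a0|a0] := leP a 0.
  rewrite max_l; last by rewrite ge_min a0.
  apply/eqP; rewrite -measure_le0.
  apply: (@le_trans _ _ (Q [set t | Y t <= 0])); last first.
    by rewrite YQ ?lexx ?ler01.
  apply: le_measure; rewrite ?inE; try exact: measurable_le.
  by move=> t /= /le_trans; apply.
have [a1|a1] := leP a 1.
  by rewrite max_r ?(ltW a0)// YQ// (ltW a0).
rewrite max_r//; apply/eqP; rewrite eq_le probability_le1; last first.
  exact: measurable_le.
apply: (@le_trans _ _ (Q [set t | Y t <= 1])); first by rewrite YQ ?lexx ?ler01.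
apply: le_measure; rewrite ?inE; try exact: measurable_le.
by move=> t /= /le_trans; apply; exact: ltW.
Qed.

Lemma uniform_id : has_law lam lam id.
Proof. by split => // A mA; rewrite preimage_id. Qed.

Lemma uniform_set1 a : lam [set a] = 0%E.
Proof.
apply/eqP; rewrite uniformE// -measure_le0 -(lebesgue_measure_set1 a).
by rewrite le_measure ?inE//; exact: measurableI.
Qed.

Lemma uniform_reflect : has_law lam lam (fun x => 1 - x).
Proof.
have m1 : measurable_fun setT (fun x : R => 1 - x) by exact: measurable_funB.
apply: has_law_uniform => // a /andP[a0 a1].
rewrite uniformE; last exact: measurable_le.
have -> : [set x | 1 - x <= a] `&` `[0, 1]%classic = `[1 - a, 1]%classic.
  apply/seteqP; split => x /=; rewrite !in_itv/=.
    by move=> [xa /andP[_ ->]]; rewrite lerBlDl -lerBlDr xa.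
  move=> /andP[xa ->]; rewrite lerBlDl -lerBlDr xa (le_trans _ xa)//.
  by rewrite subr_ge0.
rewrite lebesgue_measure_itv/= lte_fin -EFinB subKr.
case: ltP => // h; congr (_%:E); apply/eqP; rewrite eq_le a0/=.
by move: h; rewrite lerBrDr gerDl => ->.
Qed.

(** This is what lets almost sure arguments ignore the points where [on01] substitutes 0. *)
Lemma uniform_itvoo : {ae lam, forall x, 0 < x < 1}.
Proof.
exists ([set 0; 1] `|` ~` `[0, 1]%classic); split.
- by apply: measurableU; [apply: measurableU|exact: measurableC].
- apply: null_set_setU => //.
  + exact: measurableU.
  + exact: measurableC.
  + by apply: null_set_setU => //; exact: uniform_set1.
  + by rewrite [LHS]uniformE ?setICl ?measure0//; exact: measurableC.
- move=> x /= /negP; rewrite negb_and -!leNgt in_itv/= => H.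
  have [->|x0] := eqVneq x 0; first by left; left.
  have [->|x1] := eqVneq x 1; first by left; right.
  right; apply/negP; rewrite negb_and -!ltNge !lt_neqAle x0 eq_sym x1.
  by case/orP: H => ->; rewrite ?orbT.
Qed.

(** The image of Lebesgue measure under a translation gives half-open intervals their length, and
    uniqueness of Lebesgue measure concludes. *)
Lemma lebesgue_shift (c : R) A : measurable A ->
  mu ((fun x => x + c) @^-1` A) = mu A.
Proof.
move=> mA.
have ms : measurable_fun setT
    (fun x : measurableTypeR R => x + c : measurableTypeR R).
  by exact: measurable_funD.
pose s : {mfun (measurableTypeR R) >-> (measurableTypeR R)} :=
  HB.pack (fun x : measurableTypeR R => x + c : measurableTypeR R)
    (isMeasurableFun.Build _ _ _ _ _ ms).
apply/esym; apply: (@lebesgue_measure_unique R (pushforward mu s)) => //.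
move=> _ [[a b] /= _ <-]; rewrite /pushforward.
have -> : s @^-1` `]a, b]%classic = `]a - c, b - c]%classic.
  by apply/seteqP; split => x /=; rewrite !in_itv/= ltrBlDr lerBrDr.
by rewrite !lebesgue_measure_itv/= !lte_fin ltrD2r -!EFinB opprB addrA subrK.
Qed.

Lemma uniform_shift (c : R) (A : set (measurableTypeR R)) :
  measurable A -> A `<=` `[0, 1]%classic ->
  (fun x => x + c) @^-1` A `<=` `[0, 1]%classic ->
  lam ((fun x => x + c) @^-1` A) = lam A.
Proof.
move=> mA A01 cA01; have mcA : measurable ((fun x => x + c) @^-1` A).
  by apply: measurable_preimage => //; exact: measurable_funD.
by rewrite !uniformE// !setIidl// lebesgue_shift.
Qed.

(** The margin conditions describe each variable only on the event that the other is at most 1. That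
    event has probability 1 because the copula is 1 at (1, 1), so [full] can drop it. *)
Lemma joint_df_uniform d (T : measurableType d) (P : probability T R)
    (U V : T -> R) (C : copula R) : joint_df P U V C ->
  has_law P lam U /\ has_law P lam V.
Proof.
move=> [mU mV df].
have full (X : T -> R) (S : set T) : measurable S -> P S = 1%E ->
    measurable_fun setT X -> (forall u : {i01 R},
    P ([set t | X t <= u%:num] `&` S) = (u%:num)%:E) -> has_law P lam X.
  move=> mS PS mX PX; apply: has_law_uniform => // a a01.
  have {}PX : P ([set t | X t <= a] `&` S) = a%:E.
    by case/andP: a01 => a0 a1; have := PX (Itv01 a0 a1).
  have mXa : measurable [set t | X t <= a] by exact: measurable_le.
  rewrite -[RHS]PX; apply/eqP; rewrite eq_le; apply/andP; split; last first.
    by rewrite le_measure ?inE//; exact: measurableI.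
  rewrite [leLHS](measureDI P mXa mS) -[leRHS]add0e leeD2r//.
  rewrite -(_ : P (~` S) = 0%E).
    apply: le_measure; rewrite ?inE; [exact: measurableD|exact: measurableC|].
    by move=> t [].
  by rewrite [LHS]probability_setC// PS subee.
have one (X : T -> R) : measurable_fun setT X ->
    (1%:E <= P [set t | (X t <= 1)%R])%E -> P [set t | X t <= 1] = 1%E.
  move=> mX PX; apply/eqP; rewrite eq_le PX probability_le1//.
  exact: measurable_le.
have df1 : P [set t | U t <= 1 /\ V t <= 1] = 1%E.
  by rewrite (df 1%:i01 1%:i01) copula_margin1.
split.
- apply: (full U [set t | V t <= 1]) => //; first exact: measurable_le.
    apply: one => //; rewrite -df1; apply: le_measure; rewrite ?inE.
    + by apply: measurableI; exact: measurable_le.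
    + exact: measurable_le.
    + by move=> t [].
  by move=> u; rewrite -[in RHS](copula_margin1 C u) -df.
- apply: (full V [set t | U t <= 1]) => //; first exact: measurable_le.
    apply: one => //; rewrite -df1; apply: le_measure; rewrite ?inE.
    + by apply: measurableI; exact: measurable_le.
    + exact: measurable_le.
    + by move=> t [].
  by move=> u; rewrite -[in RHS](copula_margin2 C u) -df setIC.
Qed.

Lemma law_joint_df (C : copula R) : joint_df (law C) fst snd C.
Proof. by rewrite /law; case: cid. Qed.

(** The copula is the joint distribution function restricted to the unit square, carried by the law
    of the pair. Its margins are right because each variable is almost surely at most 1. Later
    copulas are all produced this way from measure-preserving maps of the unit interval. *)
Lemma uniform_copula d (T : measurableType d) (P : probability T R)
    (U V : T -> R) : has_law P lam U -> has_law P lam V ->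
  exists C : copula R, joint_df P U V C.
Proof.
move=> [mU PU] [mV PV].
have mle u v : measurable [set t | U t <= u /\ V t <= v].
  by apply: measurableI; exact: measurable_le.
have C0 u v : 0 <= fine (P [set t | U t <= u /\ V t <= v]) by exact: fine_ge0.
have C1 u v : fine (P [set t | U t <= u /\ V t <= v]) <= 1.
  by rewrite -lee_fin fineK ?fin_num_measure// probability_le1.
pose C (u v : {i01 R}) : {i01 R} := Itv01 (C0 u%:num v%:num) (C1 u%:num v%:num).
have CE u v : P [set t | U t <= u%:num /\ V t <= v%:num] = ((C u v)%:num)%:E.
  by rewrite /= fineK ?fin_num_measure.
have PX1 (X : T -> R) : has_law P lam X -> P [set t | X t <= 1] = 1%E.
  move=> [mX XE]; rewrite (XE [set x | x <= 1]) ?uniform_le ?lexx ?ler01//.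
  exact: measurable_le.
have dfC : joint_df P U V C by split.
have df : exists nu : probability (R * R)%type R, joint_df nu fst snd C.
  have mUV : measurable_fun setT (fun t => (U t, V t)).
    exact: measurable_fun_pair.
  pose UV : {mfun T >-> (R * R)%type} :=
    HB.pack (fun t => (U t, V t)) (isMeasurableFun.Build _ _ _ _ _ mUV).
  by exists (distribution P UV); split => // u v; rewrite -CE.
have mUl u : measurable [set t | U t <= u] by exact: measurable_le.
have mVl u : measurable [set t | V t <= u] by exact: measurable_le.
have m1 u : C u 1%:i01 = u.
  apply: val_inj; apply: EFin_inj.
  transitivity (P [set t | U t <= u%:num /\ V t <= 1]).
    by rewrite (CE u 1%:i01).
  rewrite -[RHS](uniform_le (a := u%:num)); last by rewrite ge0 le1.
  rewrite -PU; last exact: measurable_le.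
  rewrite [RHS](measureDI P (mUl _) (mVl 1)) -[LHS]add0e; congr (_ + _)%E.
  apply/esym/eqP; rewrite -measure_le0.
  apply: (@le_trans _ _ (P (~` [set t | V t <= 1]))).
    apply: le_measure; rewrite ?inE; [exact: measurableD|exact: measurableC|].
    by move=> t [].
  by rewrite probability_setC// PX1// subee.
have m2 u : C 1%:i01 u = u.
  apply: val_inj; apply: EFin_inj.
  transitivity (P [set t | U t <= 1 /\ V t <= u%:num]).
    by rewrite (CE 1%:i01 u).
  rewrite -[RHS](uniform_le (a := u%:num)); last by rewrite ge0 le1.
  rewrite -PV; last exact: measurable_le.
  rewrite [RHS](measureDI P (mVl _) (mUl 1)) -[LHS]add0e; congr (_ + _)%E.
    apply/esym/eqP; rewrite -measure_le0.
    apply: (@le_trans _ _ (P (~` [set t | U t <= 1]))).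
      apply: le_measure; rewrite ?inE; [exact: measurableD|exact: measurableC|].
      by move=> t [].
    by rewrite probability_setC// PX1// subee.
  by congr (P _); rewrite setIC.
by exists (Copula df m1 m2).
Qed.

End uniform.

(** * Approximation by step functions *)

Section covariance_sums.
Context d (T : measurableType d) (R : realType) (P : probability T R).

Lemma Lfun2_sum N (F : nat -> T -> R) :
  (forall i, F i \in Lfun P 2%:E) ->
  (fun t => \sum_(i < N) F i t) \in Lfun P 2%:E.
Proof.
move=> F2; elim: N => [|N IH].
  have -> : (fun t => \sum_(i < 0) F i t) = cst 0.
    by apply/funext => t; rewrite big_ord0.
  exact: Lfun_cst.
have -> : (fun t => \sum_(i < N.+1) F i t) =
    (fun t => \sum_(i < N) F i t) \+ F N.
  by apply/funext => t; rewrite big_ord_recr.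
exact: Lfun2D.
Qed.

Lemma cov_suml N (F : nat -> T -> R) Z :
  (forall i, F i \in Lfun P 2%:E) -> Z \in Lfun P 2%:E ->
  cov P (fun t => \sum_(i < N) F i t) Z = \sum_(i < N) cov P (F i) Z.
Proof.
move=> F2 Z2; elim: N => [|N IH].
  have -> : (fun t => \sum_(i < 0) F i t) = cst 0.
    by apply/funext => t; rewrite big_ord0.
  by rewrite cov_cstl big_ord0.
rewrite big_ord_recr/= -IH -covDl//; last exact: Lfun2_sum.
by congr cov; apply/funext => t; rewrite big_ord_recr.
Qed.

End covariance_sums.

Section step.
Context (R : realType).

(** For [i] below [2 * n.+1 ^ 2] these points run from [- n.+1] up to one mesh, [1 / n.+1], below
    [n.+1]. *)
Definition threshold n i : R := i%:R / n.+1%:R - n.+1%:R.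

(* The identity truncated to [- (n + 1), n + 1] and rounded to a grid of step
   1 / (n + 1), written as a combination of indicators of rays. *)
Definition step n (x : R) : R :=
  n.+1%:R^-1 * (\sum_(i < (2 * n.+1 ^ 2)%N) (threshold n i < x)%R%:R) - n.+1%:R.

(** The sum counts the naturals below both [y] and [N]: it is the ceiling of [y] clamped to the
    interval from 0 to [N]. *)
Lemma count_lt (y : R) N :
  `|\sum_(i < N) (i%:R < y)%R%:R - Num.max 0 (Num.min y N%:R)| <= 1.
Proof.
elim: N => [|N IH].
  rewrite big_ord0 max_l; first by rewrite subrr normr0.
  by rewrite ge_min lexx orbT.
have [yN|Ny] := leP y N%:R.
  rewrite big_ord_recr/= ltNge yN addr0 min_l; last first.
    by rewrite (le_trans yN)// ler_nat.
  by move: IH; rewrite min_l.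
have y0 : 0 <= y by rewrite (le_trans _ (ltW Ny)).
rewrite (eq_bigr (fun=> 1)); last first.
  move=> [i iN] _ /=; rewrite (_ : _ < _ = true)//.
  by rewrite (le_lt_trans _ Ny)// ler_nat.
rewrite sumr_const card_ord max_r; last by rewrite le_min y0 ler0n.
have : N%:R <= Num.min y N.+1%:R by rewrite le_min (ltW Ny) ler_nat leqnSn.
have : Num.min y N.+1%:R <= N.+1%:R by rewrite ge_min lexx orbT.
rewrite -natr1; move: (Num.min _ _) => z zN Nz.
by rewrite ler_norml; apply/andP; split; lra.
Qed.

Lemma threshold_lt n i (x : R) :
  (threshold n i < x) = (i%:R < n.+1%:R * (x + n.+1%:R)).
Proof. by rewrite /threshold ltrBlDr ltr_pdivrMr// mulrC. Qed.

(** Multiplied by [n.+1], this is [count_lt] at [n.+1 * (x + n.+1)] with [N = 2 * n.+1 ^ 2]. *)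
Lemma step_clamp n (x : R) :
  `|Num.max (- n.+1%:R) (Num.min x n.+1%:R) - step n x| <= n.+1%:R^-1.
Proof.
set m : R := n.+1%:R.
have m0 : 0 < m by [].
rewrite -[m^-1]mulr1 ler_pdivlMl//.
rewrite -[X in X * _](gtr0_norm m0) -normrM mulrBr distrC.
have := count_lt (m * (x + m)) (2 * n.+1 ^ 2).
have -> : (2 * n.+1 ^ 2)%:R = m * (m + m).
  by rewrite natrM natrX -/m; ring.
have -> : Num.max 0 (Num.min (m * (x + m)) (m * (m + m))) =
    m * (Num.max (- m) (Num.min x m) + m).
  rewrite -minr_pMr ?ltW// -addr_minl -[X in Num.max X _](mulr0 m).
  by rewrite -maxr_pMr ?ltW// addr_maxl addNr.
rewrite (eq_bigr (fun i : 'I__ => (threshold n i < x)%R%:R)); last first.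
  by move=> i _; rewrite threshold_lt.
have -> : m * step n x =
    \sum_(i < (2 * n.+1 ^ 2)%N) (threshold n i < x)%R%:R - m * m.
  by rewrite /step mulrBr mulVKf ?gt_eqF.
by rewrite mulrDr opprD (addrC (- _) (- (m * m))) addrA.
Qed.

Lemma step_dist n (x : R) : `|x| <= n.+1%:R -> `|x - step n x| <= n.+1%:R^-1.
Proof.
rewrite ler_norml => /andP[mx xm].
by have := step_clamp n x; rewrite min_l// max_r.
Qed.

(** Truncation moves [x] by at most its absolute value and rounding by at most 1. Being free of [n],
    the bound serves as the dominating function in [step_cvg]. *)
Lemma step_dist_le n (x : R) : `|x - step n x| <= `|x| + 1.
Proof.
set m : R := n.+1%:R; have m0 : 0 < m by [].
pose z := Num.max (- m) (Num.min x m).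
have -> : x - step n x = (x - z) + (z - step n x) by rewrite addrA subrK.
rewrite (le_trans (ler_normD _ _))// lerD//; last first.
  by rewrite (le_trans (step_clamp n x))// invf_le1// ler1n.
rewrite /z; have [xm|mx] := leP x m.
  have [mx|xm'] := leP (- m) x; first by rewrite subrr normr0.
  by rewrite !ler0_norm//; lra.
have [_|mm] := leP (- m) m; first by rewrite !ger0_norm; lra.
by lra.
Qed.

End step.

Section step_moments.
Context d (T : measurableType d) (R : realType) (P : probability T R).
Implicit Types X Y : T -> R.

Lemma measurable_lt X a : measurable_fun setT X -> measurable [set t | a < X t].
Proof.
move=> mX; have -> : [set t | a < X t] = ~` [set t | X t <= a].
  by apply/seteqP; split => t /=; rewrite ltNge => /negP.
by apply: measurableC; exact: measurable_le.
Qed.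

Lemma Lfun2_gt X a : measurable_fun setT X ->
  (fun t => (a < X t)%R%:R : R) \in Lfun P 2%:E.
Proof.
move=> mX; apply: (@Lfun2_bounded _ _ _ _ _ 1).
  have -> : (fun t => (a < X t)%R%:R) = \1_[set t | a < X t] :> (T -> R).
    by apply/funext => t; rewrite indicE mem_setE.
  by apply: measurable_indic; exact: measurable_lt.
by move=> t; case: (_ < _); rewrite ?normr1 ?normr0.
Qed.

Lemma step_comp n X : step n \o X =
  n.+1%:R^-1 \o*
    (fun t => \sum_(i < (2 * n.+1 ^ 2)%N) (threshold R n i < X t)%R%:R)
  \- cst n.+1%:R.
Proof. by apply/funext => t /=; rewrite mulrC. Qed.

Lemma Lfun2_step n X : measurable_fun setT X -> step n \o X \in Lfun P 2%:E.
Proof.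
move=> mX; rewrite step_comp; apply: Lfun2B; last exact: Lfun_cst.
apply: Lfun2Z.
apply: (Lfun2_sum _ (F := fun i t => (threshold R n i < X t)%R%:R)).
by move=> i; exact: Lfun2_gt.
Qed.

Lemma cov_step n X Y : measurable_fun setT X -> measurable_fun setT Y ->
  cov P (step n \o X) (step n \o Y) = n.+1%:R^-1 * (n.+1%:R^-1 *
   \sum_(i < (2 * n.+1 ^ 2)%N) \sum_(j < (2 * n.+1 ^ 2)%N)
     cov P (fun t => (threshold R n i < X t)%R%:R)
           (fun t => (threshold R n j < Y t)%R%:R)).
Proof.
move=> mX mY.
have X2 i := Lfun2_gt (threshold R n i) mX.
have Y2 i := Lfun2_gt (threshold R n i) mY.
have SX2 := Lfun2_sum (2 * n.+1 ^ 2) X2.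
have SY2 := Lfun2_sum (2 * n.+1 ^ 2) Y2.
have sY2 := Lfun2_step n mY.
rewrite [step n \o X in LHS]step_comp covBl ?Lfun2Z ?Lfun_cst// cov_cstl subr0.
rewrite covZl// step_comp covBr ?Lfun2Z ?Lfun_cst// cov_cstr subr0 covZr//.
congr (_ * (_ * _)); rewrite (cov_suml _ X2)//; apply: eq_bigr => i _.
by rewrite covC (cov_suml _ Y2)//; apply: eq_bigr => j _; rewrite covC.
Qed.

(** Passing to the complementary events changes two signs, hence nothing. The result is the
    integrand of Hoeffding's covariance formula: it sees the coupling only through the joint
    distribution function. *)
Lemma cov_gt X Y a b : measurable_fun setT X -> measurable_fun setT Y ->
  cov P (fun t => (a < X t)%R%:R) (fun t => (b < Y t)%R%:R) =
  fine (P [set t | X t <= a /\ Y t <= b]) -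
  fine (P [set t | X t <= a]) * fine (P [set t | Y t <= b]).
Proof.
move=> mX mY.
have le2 (Z : T -> R) c : measurable_fun setT Z ->
    (\1_[set t | Z t <= c] : T -> R) \in Lfun P 2%:E.
  move=> mZ; apply: (@Lfun2_bounded _ _ _ _ _ 1).
    by apply: measurable_indic; exact: measurable_le.
  by move=> t; rewrite indicE; case: (_ \in _); rewrite ?normr1 ?normr0.
have gtE (Z : T -> R) c :
    (fun t => (c < Z t)%R%:R) = cst 1 \- \1_[set t | Z t <= c] :> (T -> R).
  apply/funext => t /=; rewrite indicE ltNge.
  have -> : (t \in [set t | Z t <= c]) = (Z t <= c).
    by apply/idP/idP; rewrite inE.
  by case: (Z t <= c); rewrite /= ?subrr ?subr0.
have X2 := le2 _ a mX; have Y2 := le2 _ b mY.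
rewrite (gtE X a) (gtE Y b) covBl ?Lfun2B ?Lfun_cst// cov_cstl sub0r.
rewrite covBr ?Lfun_cst// cov_cstr sub0r opprK covE//.
rewrite !expectation_indic; try exact: measurable_le.
have -> : \1_[set t | X t <= a] \* \1_[set t | Y t <= b] =
    \1_([set t | X t <= a] `&` [set t | Y t <= b]) :> (T -> R).
  by rewrite indicI.
by rewrite expectation_indic//; apply: measurableI; exact: measurable_le.
Qed.

(** Dominated convergence of the squared error, under the bound of [step_dist_le]; the variance of
    the error is at most its second moment. *)
Lemma step_cvg X : X \in Lfun P 2%:E ->
  cov P (X \- (step n \o X)) (X \- (step n \o X)) @[n --> \oo] --> 0.
Proof.
move=> X2; have mX := Lfun_measurable X2.
pose D n := X \- (step n \o X).
have D2 n : D n \in Lfun P 2%:E by apply: Lfun2B => //; exact: Lfun2_step.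
have intD : (\int[P]_t ((D n t) ^+ 2)%:E @[n --> \oo] -->
    \int[P]_t (cst 0 t))%E.
  have intg : P.-integrable setT (EFin \o (fun t => (`|X t| + 1) ^+ 2)).
    apply: Lfun2_integrable_sqr.
    apply: (@Lfun2D _ _ _ _ (fun t => `|X t|) (cst 1)); last exact: Lfun_cst.
    have /Lfun2P[_ fX] := X2; apply/Lfun2P.
    split; first exact: measurableT_comp.
    by under eq_integral do rewrite -normrX ger0_norm ?sqr_ge0//.
  have := @dominated_convergence _ _ _ P setT measurableT
    (fun n t => ((D n t) ^+ 2)%:E) (cst 0%E) _ _ _ _ intg.
  case => //.
  - move=> n; apply/measurable_EFinP; apply: measurable_funX.
    exact: Lfun_measurable (D2 n).
  - apply: aeW => t _; apply/fine_cvgP; split; first by apply: nearW.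
    suff D0 : D n t @[n --> \oo] --> 0.
      have := cvgM D0 D0; rewrite mulr0; exact.
    apply: (@squeeze_cvgr _ _ _ _ (fun n => - harmonic n) harmonic).
    + near=> n; rewrite -ler_norml; apply: step_dist.
      (* From this rank on, [X t] lies within the truncation range and only the rounding error is
         left. *)
      near: n; exists (Num.bound `|X t|) => // n /= tn.
      rewrite (le_trans (ltW (archi_boundP _)))// ler_nat.
      exact: leq_trans tn _.
    + by rewrite -oppr0; apply: cvgN; exact: cvg_harmonic.
    + exact: cvg_harmonic.
  - apply: aeW => t n _; rewrite gee0_abs ?lee_fin ?sqr_ge0//.
    rewrite -[(D n t) ^+ 2]ger0_norm ?sqr_ge0// normrX lerXn2r ?nnegrE//.
    by rewrite step_dist_le.
move: intD; rewrite integral0 => intD.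
apply: (@squeeze_cvgr _ _ _ _ (cst 0)
  (fun n => fine (\int[P]_t ((D n t) ^+ 2)%:E)%E)).
- apply: nearW => n; rewrite cov_ge0 -/(D n) (covE (D2 n) (D2 n)).
  rewrite -expr2 lerBlDr.
  have -> : 'E_P[D n \* D n]%E = (\int[P]_t ((D n t) ^+ 2)%:E)%E.
    by rewrite unlock.
  by rewrite lerDl sqr_ge0.
- exact: cvg_cst.
- exact: fine_cvg.
Unshelve. all: by end_near. Qed.

End step_moments.

Lemma probability_ae d (T : measurableType d) (R : realType)
    (P : probability T R) (A B : set T) : measurable A -> measurable B ->
  {ae P, forall t, A t <-> B t} -> P A = P B.
Proof.
move=> mA mB AB; rewrite -!expectation_indic//; apply: expectation_ae => //.
apply: filterS AB => t ABt; rewrite !indicE; congr (_%:R).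
by congr nat_of_bool; apply/idP/idP; rewrite !inE => /ABt.
Qed.

(** * Covariance of a quantile-like function as a function of the copula *)

Section quantile_like.
Context (R : realType).

Local Notation lam :=
  [the probability (measurableTypeR R) R of uniform_prob (@ltr01 R)].

Variables (f : R -> R) (G : R -> {i01 R}).
Hypothesis f2 : (f : measurableTypeR R -> R) \in Lfun lam 2%:E.
Hypothesis fG : forall t p, 0 < p < 1 -> (f p <= t) = (p <= (G t)%:num).

Let mf : measurable_fun setT f.
Proof. exact: Lfun_measurable f2. Qed.

Definition copula_cov (C : copula R) : R :=
  cov (law C) (f \o fst) (f \o snd).

(** Apart from a constant free of [C], this is a finite combination of values of [C] with
    nonnegative coefficients, so monotonicity and pointwise continuity in [C] can be read off. *)
Definition step_cov n (C : copula R) : R :=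
  n.+1%:R^-1 * (n.+1%:R^-1 *
   \sum_(i < (2 * n.+1 ^ 2)%N) \sum_(j < (2 * n.+1 ^ 2)%N)
     ((C (G (threshold R n i)) (G (threshold R n j)))%:num -
      (G (threshold R n i))%:num * (G (threshold R n j))%:num)).

Definition step_var n : R :=
  cov lam (f \- (step n \o f)) (f \- (step n \o f)).

(** By [fG], the events that [f] is at most [s] and that the uniform variable is at most [G s] agree
    almost surely. The joint distribution function of the transformed pair at ([s], [t]) is thus
    [C (G s) (G t)], and [cov_gt] applies to each pair of thresholds. *)
Lemma cov_step_copula n (C : copula R) :
  cov (law C) (step n \o (f \o fst)) (step n \o (f \o snd)) = step_cov n C.
Proof.
have dfC := law_joint_df C; have [[mU PU] [mV PV]] := joint_df_uniform dfC.
have [_ _ df] := dfC.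
have mX : measurable_fun setT (f \o fst : R * R -> R).
  exact: measurableT_comp.
have mY : measurable_fun setT (f \o snd : R * R -> R).
  exact: measurableT_comp.
have aeU := has_law_ae (conj mU PU) (uniform_itvoo R).
have aeV := has_law_ae (conj mV PV) (uniform_itvoo R).
have aX : {ae law C, forall w, forall s, (f w.1 <= s) = (w.1 <= (G s)%:num)}.
  by apply: filterS aeU => w w01 s; rewrite fG.
have aY : {ae law C, forall w, forall s, (f w.2 <= s) = (w.2 <= (G s)%:num)}.
  by apply: filterS aeV => w w01 s; rewrite fG.
have G01 s : 0 <= (G s)%:num <= (1 : R) by rewrite ge0 le1.
have PX s : law C [set w | f w.1 <= s] = ((G s)%:num)%:E.
  rewrite -(uniform_le (G01 s)) -PU; last exact: measurable_le.
  apply: probability_ae; [exact: (measurable_le _ mX)|exact: measurable_le|].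
  by apply: filterS aX => w /= ->.
have PY s : law C [set w | f w.2 <= s] = ((G s)%:num)%:E.
  rewrite -(uniform_le (G01 s)) -PV; last exact: measurable_le.
  apply: probability_ae; [exact: (measurable_le _ mY)|exact: measurable_le|].
  by apply: filterS aY => w /= ->.
have PXY s t :
    law C [set w | f w.1 <= s /\ f w.2 <= t] = ((C (G s) (G t))%:num)%:E.
  rewrite -df; apply: probability_ae.
  - apply: measurableI; first exact: (measurable_le _ mX).
    exact: (measurable_le _ mY).
  - by apply: measurableI; exact: measurable_le.
  - by apply: filterS2 aX aY => w /= -> ->.
rewrite cov_step//; congr (_ * (_ * _)); apply: eq_bigr => i _.
by apply: eq_bigr => j _; rewrite cov_gt//= PXY PX PY.
Qed.

(** With [D] the error of the step, the difference is a sum of three covariances, each involving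
    [D]. Cauchy-Schwarz bounds them by variances of single margins, which are uniform whatever [C]
    is: the bound does not depend on [C]. *)
Lemma copula_cov_step_dist n (C : copula R) :
  `|copula_cov C - step_cov n C| <=
  2 * Num.sqrt (cov lam f f) * Num.sqrt (step_var n) + step_var n.
Proof.
have [lU lV] := joint_df_uniform (law_joint_df C).
pose D := f \- (step n \o f).
have D2 : (D : measurableTypeR R -> R) \in Lfun lam 2%:E.
  by apply: Lfun2B => //; exact: Lfun2_step.
have fU2 : (f \o fst : R * R -> R) \in Lfun (law C) 2%:E := has_law_Lfun2 lU f2.
have fV2 : (f \o snd : R * R -> R) \in Lfun (law C) 2%:E := has_law_Lfun2 lV f2.
have DU2 : (D \o fst : R * R -> R) \in Lfun (law C) 2%:E := has_law_Lfun2 lU D2.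
have DV2 : (D \o snd : R * R -> R) \in Lfun (law C) 2%:E := has_law_Lfun2 lV D2.
have mD : measurable_fun setT D := Lfun_measurable D2.
have fU : cov (law C) (f \o fst) (f \o fst) = cov lam f f.
  by rewrite /cov (has_law_covariance lU).
have fV : cov (law C) (f \o snd) (f \o snd) = cov lam f f.
  by rewrite /cov (has_law_covariance lV).
have DU : cov (law C) (D \o fst) (D \o fst) = step_var n.
  by rewrite /cov (has_law_covariance lU).
have DV : cov (law C) (D \o snd) (D \o snd) = step_var n.
  by rewrite /cov (has_law_covariance lV).
rewrite -cov_step_copula /copula_cov.
have -> : step n \o (f \o fst) = (f \o fst) \- (D \o fst) :> (R * R -> R).
  by apply/funext => w; rewrite /D /= opprB addrC subrK.
have -> : step n \o (f \o snd) = (f \o snd) \- (D \o snd) :> (R * R -> R).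
  by apply/funext => w; rewrite /D /= opprB addrC subrK.
rewrite (covBl fU2 DU2 (Lfun2B fV2 DV2)).
rewrite (covBr fV2 DV2 fU2) (covBr fV2 DV2 DU2).
have := cov_le fU2 DV2; have := cov_le DU2 fV2; have := cov_le DU2 DV2.
rewrite fU fV DU DV -[in X in X -> _]expr2 sqr_sqrtr; last exact: cov_ge0.
rewrite !ler_norml => /andP[a1 b1] /andP[a2 b2] /andP[a3 b3].
by apply/andP; split; lra.
Qed.

Lemma step_dist_cvg :
  2 * Num.sqrt (cov lam f f) * Num.sqrt (step_var n) + step_var n
    @[n --> \oo] --> 0.
Proof.
have sv : step_var n @[n --> \oo] --> 0 by exact: step_cvg.
have sq : Num.sqrt (step_var n) @[n --> \oo] --> 0.
  rewrite -[X in _ --> X](@sqrtr0 R).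
  exact: (cvg_comp _ _ sv (@sqrt_continuous R 0)).
rewrite -[X in _ --> X]addr0; apply: cvgD => //.
rewrite -[X in _ --> X](mulr0 (2 * Num.sqrt (cov lam f f))).
by apply: cvgM; first exact: cvg_cst.
Qed.

Lemma step_cov_cvg (C : copula R) : step_cov n C @[n --> \oo] --> copula_cov C.
Proof.
apply/cvgrPdist_le => e e0; near=> n.
rewrite (le_trans (copula_cov_step_dist n C))//.
near: n; have /cvgrPdist_le/(_ e e0) := step_dist_cvg; apply: filterS => n.
by rewrite sub0r normrN; apply: le_trans; exact: ler_norm.
Unshelve. all: by end_near. Qed.

Lemma copula_cov_le (C C' : copula R) :
  (forall u v, (C u v)%:num <= (C' u v)%:num) -> copula_cov C <= copula_cov C'.
Proof.
move=> CC'.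
apply: (ler_cvg_to (step_cov_cvg (C := C)) (step_cov_cvg (C := C'))).
apply: nearW => n; rewrite !ler_pM2l ?invr_gt0//.
by apply: ler_sum => i _; apply: ler_sum => j _; rewrite lerD2r.
Qed.

(** A bound in three parts: one rank [k] makes the step error at most [e / 3] for all copulas at
    once, and at that fixed [k] only finitely many values of the copulas have to converge. *)
Lemma copula_cov_cvg (C_ : nat -> copula R) (C : copula R) :
  (forall u v, (C_ n u v)%:num @[n --> \oo] --> (C u v)%:num) ->
  copula_cov (C_ n) @[n --> \oo] --> copula_cov C.
Proof.
move=> CC; apply/cvgrPdist_le => e e0.
have e3 : 0 < e / 3 by rewrite divr_gt0.
have [k _ kP] := cvgr_dist_le _ _ step_dist_cvg _ e3.
have {kP} := kP k (leqnn k).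
rewrite sub0r normrN => /(le_trans (ler_norm _)) ek.
have stepC : step_cov k (C_ n) @[n --> \oo] --> step_cov k C.
  do 2 (apply: cvgM; first exact: cvg_cst).
  apply: cvg_big; [exact: add_continuous|move=> i _].
  apply: cvg_big; [exact: add_continuous|move=> j _].
  by apply: cvgB; [exact: CC|exact: cvg_cst].
near=> n.
have H1 := le_trans (copula_cov_step_dist k C) ek.
have H2 := le_trans (copula_cov_step_dist k (C_ n)) ek.
have H3 : `|step_cov k C - step_cov k (C_ n)| <= e / 3.
  by near: n; move/cvgrPdist_le: stepC; exact.
move: H1 H2 H3; rewrite !ler_norml => /andP[? ?] /andP[? ?] /andP[? ?].
by apply/andP; split; lra.
Unshelve. all: by end_near. Qed.

End quantile_like.

(** * Coherence forces monotonicity *)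

Section swap.
Context (R : realType).

Local Notation lam :=
  [the probability (measurableTypeR R) R of uniform_prob (@ltr01 R)].

(** The intervals are closed on the right because the functions considered are left-continuous; open
    on the left, they are disjoint as soon as [a <= b - h]. *)
Definition swap (h a b x : R) : R :=
  if a - h < x <= a then x + (b - a)
  else if b - h < x <= b then x - (b - a) else x.

Lemma swapK h a b : a <= b - h -> involutive (swap h a b).
Proof.
move=> ab x; rewrite /swap.
case: (boolP (a - h < x <= a)) => [/andP[x1 x2]|xa].
  rewrite ifF; last by apply/negbTE/negP => /andP[]; lra.
  by rewrite ifT; [lra|apply/andP; split; lra].
case: (boolP (b - h < x <= b)) => [/andP[x1 x2]|xb].
  by rewrite ifT; [lra|apply/andP; split; lra].
by rewrite (negbTE xa) (negbTE xb).
Qed.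

Lemma measurable_swap h a b : measurable_fun setT (swap h a b).
Proof.
have mb (c : R) : measurable_fun setT (fun x : R => c - h < x <= c).
  apply: measurable_and => //.
    exact: measurable_fun_ltr.
  exact: measurable_fun_ler.
apply: measurable_fun_ifT => //; first exact: measurable_funD.
by apply: measurable_fun_ifT => //; exact: measurable_funB.
Qed.

(** A set is cut along the two intervals [I] and [J] and the rest: the map translates the pieces in
    [I] and [J] onto each other's place and fixes the rest, so translation invariance suffices. *)
Lemma uniform_swap h a b : 0 < h -> 0 <= a - h -> a <= b - h -> b <= 1 ->
  has_law lam lam (swap h a b).
Proof.
move=> h0 a0 ab b1; split; first exact: measurable_swap.
move=> A mA.
pose I : set (measurableTypeR R) := `]a - h, a]%classic.
pose J : set (measurableTypeR R) := `]b - h, b]%classic.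
have mI : measurable I := measurable_itv _.
have mJ : measurable J := measurable_itv _.
have JI0 : J `&` I = set0.
  apply/seteqP; split => x //; rewrite /I /J /= !in_itv/=.
  move=> [] /andP[x1 x2] /andP[x3 x4].
  by lra.
have split3 (B : set (measurableTypeR R)) : measurable B ->
    lam B = (lam (B `&` I) + (lam (B `&` J) + lam (B `\` I `\` J)))%E.
  move=> mB; rewrite [LHS](measureDI lam mB mI) addeC; congr (_ + _)%E.
  have mBI : measurable (B `\` I) by exact: measurableD.
  rewrite [LHS](measureDI lam mBI mJ) addeC; congr (lam _ + _)%E.
  apply/seteqP; split => x [] => [[Bx _]|Bx] Jx; split => //; split => //.
  by move=> Ix; rewrite -[False]/(set0 x) -JI0.
have mS : measurable (swap h a b @^-1` A).
  by apply: measurable_preimage => //; exact: measurable_swap.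
have SJ : swap h a b @^-1` A `&` J = (fun x => x + (a - b)) @^-1` (A `&` I).
  apply/seteqP; split => x; rewrite /I /J /= !in_itv/= /swap.
    move=> [Ax /andP[x1 x2]]; move: Ax; rewrite ifF; last first.
      by apply/negbTE/negP => /andP[]; lra.
    by rewrite x1 x2 opprB => Ax; split => //; apply/andP; split; lra.
  move=> [Ax /andP[x1 x2]]; split; last by apply/andP; split; lra.
  rewrite ifF; last by apply/negbTE/negP => /andP[]; lra.
  by rewrite ifT ?opprB//; apply/andP; split; lra.
have SI : swap h a b @^-1` A `&` I = (fun x => x + (b - a)) @^-1` (A `&` J).
  apply/seteqP; split => x; rewrite /I /J /= !in_itv/= /swap.
    move=> [Ax xI]; move: Ax; rewrite xI => Ax.
    by case/andP: xI => x1 x2; split => //; apply/andP; split; lra.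
  move=> [Ax /andP[x1 x2]]; have xI : a - h < x <= a by apply/andP; split; lra.
  by rewrite xI.
have SO : swap h a b @^-1` A `\` I `\` J = A `\` I `\` J.
  apply/seteqP; split => x; rewrite /I /J /= !in_itv/= /swap.
    move=> [[Ax /negP xI] /negP xJ]; move: Ax.
    by rewrite (negbTE xI) (negbTE xJ).
  by move=> [[Ax /negP xI] /negP xJ]; rewrite (negbTE xI) (negbTE xJ).
rewrite (split3 _ mS) (split3 _ mA) SI SJ SO [RHS]addeCA.
congr (_ + (_ + _))%E; apply: uniform_shift.
- exact: measurableI.
- move=> x [_]; rewrite /I /J /= !in_itv/= => /andP[x1 x2].
  by apply/andP; split; lra.
- move=> x [_]; rewrite /I /J /= !in_itv/= => /andP[x1 x2].
  by apply/andP; split; lra.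
- exact: measurableI.
- move=> x [_]; rewrite /I /J /= !in_itv/= => /andP[x1 x2].
  by apply/andP; split; lra.
- move=> x [_]; rewrite /I /J /= !in_itv/= => /andP[x1 x2].
  by apply/andP; split; lra.
Qed.

End swap.

(** The first factor on the right has mean 0, so the right side is a covariance and expands into
    four terms. As [s] preserves [P] and is its own inverse, they are equal in pairs, whence the
    factor 2. *)
Lemma involution_cov d (T : measurableType d) (R : realType)
    (P : probability T R) (s : T -> T) (X Y : T -> R) :
  has_law P P s -> involutive s -> X \in Lfun P 2%:E -> Y \in Lfun P 2%:E ->
  2 * (cov P (X \o s) Y - cov P X Y) =
  fine 'E_P[(((X \o s) \- X) \* (Y \- (Y \o s)))%R]%E.
Proof.
move=> sP sK X2 Y2.
have Xs2 := has_law_Lfun2 sP X2; have Ys2 := has_law_Lfun2 sP Y2.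
have sE Z Z' : Z \in Lfun P 2%:E -> Z' \in Lfun P 2%:E ->
    cov P (Z \o s) (Z' \o s) = cov P Z Z'.
  move=> Z2 Z'2; rewrite /cov (has_law_covariance sP)//.
    exact: Lfun_measurable Z2.
  exact: Lfun_measurable Z'2.
have E0 : fine 'E_P[((X \o s) \- X)%R]%E = 0.
  rewrite expectationB ?Lfun2_Lfun1// (has_law_expectation sP).
    by rewrite subee// expectation_fin_num// Lfun2_Lfun1.
  exact: Lfun_measurable X2.
have := covE (Lfun2B Xs2 X2) (Lfun2B Y2 Ys2).
rewrite E0 mul0r subr0 => <-.
rewrite (covBl Xs2 X2 (Lfun2B Y2 Ys2)) (covBr Y2 Ys2 Xs2) (covBr Y2 Ys2 X2).
rewrite sE//.
have -> : cov P X (Y \o s) = cov P (X \o s) Y.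
  rewrite -sE//; congr cov.
  by apply/funext => t /=; rewrite sK.
by ring.
Qed.

(** The indicator of a ray is nondecreasing: its increment has the sign of the increment of its
    argument, or vanishes. *)
Lemma gt_increments_ge0 (R : realFieldType) (p q a b u v : R) :
  0 <= (p - q) * (a - b) ->
  0 <= ((u < p)%R%:R - (u < q)%R%:R) * ((v < a)%R%:R - (v < b)%R%:R) :> R.
Proof.
move=> H; case: (ltP u p) => up; case: (ltP u q) => uq;
  case: (ltP v a) => va; case: (ltP v b) => vb /=; nra.
Qed.

(** Each factor moves by at most half of its size, hence keeps its sign and at least half of its
    absolute value. *)
Lemma near_mul_lt0 (R : realFieldType) (a b a' b' e : R) :
  e <= `|a| / 4 -> e <= `|b| / 4 -> a * b < 0 ->
  `|a - a'| <= 2 * e -> `|b - b'| <= 2 * e -> a' * b' <= a * b / 4.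
Proof.
have [a0|a0|->] := ltgtP a 0; last by rewrite mul0r ltxx.
- rewrite (ltr0_norm a0).
  have [b0|b0|->] := ltgtP b 0; last by rewrite mulr0 ltxx.
    by move=> _ _; nra.
  rewrite (gtr0_norm b0) => ea eb _ /ler_normlP[? ?] /ler_normlP[? ?].
  have : a' <= a / 2 by lra.
  have : b / 2 <= b' by lra.
  by nra.
- rewrite (gtr0_norm a0).
  have [b0|b0|->] := ltgtP b 0; last by rewrite mulr0 ltxx.
    rewrite (ltr0_norm b0) => ea eb _ /ler_normlP[? ?] /ler_normlP[? ?].
    have : a / 2 <= a' by lra.
    have : b' <= b / 2 by lra.
    by nra.
  by move=> _ _; nra.
Qed.

(** In the first two cases, [s x - x] and [t x - t (s x)] have the same sign. In the last one, which
    includes the left neighbourhood of [c], the first factor is 0, so [t] may stay unspecified. *)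
Lemma swap_swapP (R : realType) (h a b c x : R) :
  0 < h -> a <= b - h -> b <= c - h ->
  let s := swap h a b in let t := swap h a c in
  [\/ [/\ a - h < x <= a, s x = x + (b - a), t x = x + (c - a) &
          t (s x) = x + (b - a)],
      [/\ b - h < x <= b, s x = x - (b - a), t x = x & t (s x) = x + (c - b)] |
      ~~ (a - h < x <= a) /\ s x = x].
Proof.
move=> h0 ab bc s t; rewrite /s /t /swap.
case: (boolP (a - h < x <= a)) => [/[dup] xI /andP[x1 x2]|xI].
  constructor 1; split => //; rewrite ifF.
  - by rewrite ifF//; apply/negbTE/negP => /andP[]; lra.
  - by apply/negbTE/negP => /andP[]; lra.
case: (boolP (b - h < x <= b)) => [/[dup] xJ /andP[x1 x2]|xJ]; last first.
  by constructor 3; split.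
constructor 2; split => //.
  by rewrite ifF//; apply/negbTE/negP => /andP[]; lra.
rewrite ifT; last by apply/andP; split; lra.
by lra.
Qed.

(** Near [a], [b] and [c] on the left, [g] varies by less than a quarter of the smaller increment,
    so the product of the increments stays below a quarter of its negative value at [a], [b],
    [c]. *)
Lemma left_continuous_increments (R : realType) (g : R -> R) a b c :
  left_continuous01 g -> 0 < a -> a < b -> b < c -> c < 1 ->
  (g b - g a) * (g c - g b) < 0 ->
  exists h k, [/\ 0 < h, 0 <= a - h, a <= b - h & b <= c - h] /\ 0 < k /\
    forall x, a - h < x <= a ->
      (g (x + (b - a)) - g x) * (g (x + (c - a)) - g (x + (b - a))) <= - k.
Proof.
move=> g_left a0 ab bc c1 AB.
pose A := g b - g a; pose B := g c - g b.
have {}AB : A * B < 0 by [].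
pose e := Num.min `|A| `|B| / 4.
have e0 : 0 < e.
  rewrite divr_gt0// lt_min !normr_gt0; apply/andP; split.
    by apply: contraTneq AB => ->; rewrite mul0r ltxx.
  by apply: contraTneq AB => ->; rewrite mulr0 ltxx.
have near_left x : 0 < x < 1 -> exists2 d, 0 < d & forall s, 0 <= s < d ->
    `|g x - g (x - s)| < e.
  move=> x01; have := g_left x x01.
  (* The left filter omits the point itself, so [s = 0] is treated apart. *)
  move=> /cvgrPdist_lt /(_ e e0); rewrite near_withinE => /nbhs_ballP [d d0 H].
  exists d => // s /andP[s0 sd]; have [->|sn0] := eqVneq s 0.
    by rewrite subr0 subrr normr0.
  apply: H; last by rewrite ltrBlDr ltrDl lt_neqAle eq_sym sn0.
  by rewrite /ball /= opprB addrC subrK ger0_norm.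
have [a01 b01 c01] : [/\ 0 < a < 1, 0 < b < 1 & 0 < c < 1].
  by split; apply/andP; split; lra.
have [da da0 Ha] := near_left a a01.
have [db db0 Hb] := near_left b b01.
have [dc dc0 Hc] := near_left c c01.
(* The first three bounds give closeness of the values of [g]; the last three keep the
   neighbourhoods in the unit interval and disjoint. *)
pose m := Num.min (Num.min da (Num.min db dc))
                  (Num.min a (Num.min (b - a) (c - b))).
have m0 : 0 < m by rewrite !lt_min da0 db0 dc0 a0 !subr_gt0 ab bc.
have [ma mb mc] : [/\ m <= da, m <= db & m <= dc].
  by split; rewrite !ge_min lexx ?orbT.
have [m1 m2 m3] : [/\ m <= a, m <= b - a & m <= c - b].
  by split; rewrite !ge_min lexx ?orbT.
clearbody m.
exists (m / 2), (- (A * B / 4)); split; first by split; lra.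
split; first by rewrite oppr_gt0 pmulr_llt0 ?invr_gt0.
move=> x /andP[x1 x2]; rewrite opprK.
have xa : x = a - (a - x) by lra.
have xb : x + (b - a) = b - (a - x) by lra.
have xc : x + (c - a) = c - (a - x) by lra.
have := Ha (a - x); have := Hb (a - x); have := Hc (a - x).
rewrite -xa -xb -xc.
have x01 d : m <= d -> 0 <= a - x < d by move=> md; apply/andP; split; lra.
move=> /(_ (x01 _ mc)) H3 /(_ (x01 _ mb)) H2 /(_ (x01 _ ma)) H1.
have dist (u u' v v' : R) : `|u - u'| < e -> `|v - v'| < e ->
    `|v - u - (v' - u')| <= 2 * e.
  clear; rewrite !ltr_norml !ler_norml => /andP[? ?] /andP[? ?].
  by apply/andP; split; lra.
apply: (@near_mul_lt0 _ A B _ _ e) => //; try exact: dist.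
- by rewrite /e ler_pM2r// ge_min lexx.
- by rewrite /e ler_pM2r// ge_min lexx orbT.
Qed.

Section coherent_monotone.
Context (R : realType).

Local Notation lam :=
  [the probability (measurableTypeR R) R of uniform_prob (@ltr01 R)].

(** [involution_cov] is applied to the indicators that the identity exceeds [u] and that [t] exceeds
    [v]. The margins cancel because [s] preserves [lam], so twice the difference of the copulas is
    the mean of a product that is nonnegative by [gt_increments_ge0]. *)
Lemma involution_copulas (s t : R -> R) : has_law lam lam s ->
  has_law lam lam t -> involutive s ->
  (forall x, 0 <= (s x - x) * (t x - t (s x))) ->
  exists C C' : copula R, [/\ joint_df lam id t C, joint_df lam s t C' &
    forall u v, (C u v)%:num <= (C' u v)%:num].
Proof.
move=> ls lt sK st.
have [C dfC] := uniform_copula (uniform_id R) lt.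
have [C' dfC'] := uniform_copula ls lt.
exists C, C'; split => // u v.
have [ms _] := ls; have [mt _] := lt.
have mid : measurable_fun setT (id : measurableTypeR R -> R).
  exact: (uniform_id R).1.
have [_ _ /(_ u v) CE] := dfC; have [_ _ /(_ u v) CE'] := dfC'.
have X2 : (fun x : measurableTypeR R => (u%:num < id x)%R%:R : R)
    \in Lfun lam 2%:E.
  exact: Lfun2_gt.
have Y2 : (fun x : measurableTypeR R => (v%:num < t x)%R%:R : R)
    \in Lfun lam 2%:E.
  exact: Lfun2_gt.
have := involution_cov ls sK X2 Y2.
rewrite [(fun x => _) \o s]
  (_ : _ = fun x : measurableTypeR R => (u%:num < s x)%R%:R)//.
rewrite !cov_gt// CE CE' /=.
have [_ sE] := ls.
have -> : lam [set t | s t <= u%:num] = lam [set t | t <= u%:num].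
  by rewrite -(sE [set t | t <= u%:num])//; exact: measurable_le.
rewrite opprB addrA subrK => H.
rewrite -subr_ge0 -(@pmulr_rge0 _ 2)// H fine_ge0// expectation_ge0// => x /=.
exact: gt_increments_ge0.
Qed.

Lemma rho_cov d (T : measurableType d) (P : probability T R) (U V : T -> R)
    (g1 g2 : R -> R) (C : copula R) :
  rho_defined g1 g2 -> joint_df P U V C ->
  rho g1 g2 C = cov P (on01 g1 \o U) (on01 g2 \o V) /
    (Num.sqrt (cov lam (on01 g1) (on01 g1)) *
     Num.sqrt (cov lam (on01 g2) (on01 g2))).
Proof.
move=> g12 dfC; rewrite -(rhoE dfC g12); case: g12 => g1v g2v.
have m1 := Lfun_measurable (fin_pos_variance_Lfun2 g1v).
have m2 := Lfun_measurable (fin_pos_variance_Lfun2 g2v).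
have [lU lV] := joint_df_uniform dfC.
by rewrite /pearson /variance (has_law_covariance lU)// (has_law_covariance lV).
Qed.

Lemma fin_pos_variance_cov (g : measurableTypeR R -> R) :
  fin_pos_variance lam g -> 0 < cov lam g g.
Proof. by move=> [_ /andP[V0 Voo]]; rewrite fine_gt0// V0. Qed.

Definition coherent (kappa : copula R -> R) : Prop := forall C C' : copula R,
  (forall u v, (C u v)%:num <= (C' u v)%:num) -> kappa C <= kappa C'.

Variable g : R -> R.
Hypothesis g_def : rho_defined g g.
Hypothesis g_left : left_continuous01 g.
Hypothesis g_coh : coherent (rho g g).

Let f : measurableTypeR R -> R := on01 g.

(** If the product were negative, the integrand [Phi] would be nonpositive everywhere and at most
    [- k] on an interval of length [h]. Its mean would be negative, against coherence for the two
    copulas built from the swaps. *)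
Lemma coherent_increments a b c : 0 < a -> a < b -> b < c -> c < 1 ->
  0 <= (g b - g a) * (g c - g b).
Proof.
move=> a0 ab bc c1; rewrite leNgt; apply/negP => neg.
have f2 : f \in Lfun lam 2%:E := fin_pos_variance_Lfun2 g_def.1.
have V0 : 0 < cov lam f f := fin_pos_variance_cov g_def.1.
have gE x : 0 < x < 1 -> f x = g x.
  by move=> x01; rewrite /f /on01 patchE mem_set// in_itv.
have [h [k [[h0 ha hab hbc] [k0 gk]]]] :=
  left_continuous_increments g_left a0 ab bc c1 neg.
pose s := swap h a b; pose t := swap h a c.
have ls : has_law lam lam s by apply: uniform_swap => //; lra.
have lt : has_law lam lam t by apply: uniform_swap => //; lra.
have sK : involutive s by exact: swapK.
have stP x := swap_swapP x h0 hab hbc; rewrite -/s -/t /= in stP.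
have st x : 0 <= (s x - x) * (t x - t (s x)).
  have [[xI -> -> ->]|[xJ -> -> ->]|[_ ->]] := stP x; last first.
  - by rewrite subrr mul0r.
  - by clear -ab bc; nra.
  - by clear -ab bc; nra.
have [C [C' [dfC dfC' CC']]] := involution_copulas ls lt sK st.
have := g_coh CC'; rewrite (rho_cov g_def dfC) (rho_cov g_def dfC') -/f.
rewrite ler_pM2r ?invr_gt0 ?mulr_gt0 ?sqrtr_gt0//.
rewrite -subr_ge0 -(@pmulr_rge0 _ 2)//.
have ft2 := has_law_Lfun2 lt f2.
rewrite (involution_cov ls sK f2 ft2) leNgt => /negP; apply.
set Phi := (_ \* _).
have fk x : a - h < x <= a ->
    (f (x + (b - a)) - f x) * (f (x + (c - a)) - f (x + (b - a))) <= - k.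
  move=> /[dup] /gk xk /andP[x1 x2]; rewrite !gE//;
    by clear -a0 ab bc c1 x1 x2 ha hab hbc; apply/andP; split; lra.
pose I : set (measurableTypeR R) := `]a - h, a]%classic.
have mI : measurable I := measurable_itv _.
have PhiI x : k * \1_I x <= - Phi x.
  rewrite indicE /Phi /= lerNr.
  have [[xI -> -> ->]|[xJ -> -> ->]|[xI ->]] := stP x.
  - rewrite mem_set; last by rewrite /I /= in_itv.
    by rewrite mulr1; exact: fk.
  (* Near [b] the integrand takes the value it has at the translate [x - (b - a)] near [a]; only its
     sign is kept. *)
  - rewrite memNset; last first.
      by rewrite /I /= in_itv/= => /andP[]; case/andP: xJ; lra.
    have yI : a - h < x - (b - a) <= a.
      by case/andP: xJ => ? ?; apply/andP; split; lra.
    have := fk _ yI; rewrite subrK.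
    have -> : x - (b - a) + (c - a) = x + (c - b) by lra.
    rewrite mulr0 oppr0 -mulrNN !opprB => /le_trans; apply.
    by rewrite oppr_le0 ltW.
  - rewrite memNset ?mulr0 ?oppr0 ?subrr ?mul0r//.
    by rewrite /I /= in_itv/=; exact/negP.
have Phi1 : Phi \in Lfun lam 1.
  have fs2 := has_law_Lfun2 ls f2; have fts2 := has_law_Lfun2 ls ft2.
  exact: Lfun2_mul_Lfun1 (Lfun2B fs2 f2) (Lfun2B ft2 fts2).
have NPhi1 : (fun x => - Phi x : R) \in Lfun lam 1 by rewrite rpredN.
(* [expectation_le] compares nonnegative variables, hence the passage to the opposite of [Phi]. *)
pose NPhi x := - Phi x.
have EPhi : 'E_lam[Phi]%E = (- 'E_lam[NPhi])%E.
  rewrite -[RHS]mulN1e -expectationZl//; congr expectation.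
  by apply/funext => x; rewrite /= /NPhi mulrN1 opprK.
have I1 : (\1_I : measurableTypeR R -> R) \in Lfun lam 1.
  apply: Lfun2_Lfun1; apply: (@Lfun2_bounded _ _ _ _ _ 1).
    exact: measurable_indic.
  by move=> x; rewrite indicE; case: (_ \in _); rewrite ?normr1 ?normr0.
have lamI : lam I = h%:E.
  rewrite uniformE// setIidl; last first.
    by move=> x; rewrite /I /= !in_itv/= => /andP[? ?]; apply/andP; split; lra.
  by rewrite lebesgue_measure_itv/= lte_fin ifT -?EFinB; [congr (_%:E)|]; lra.
have : ('E_lam[k \o* \1_I] <= 'E_lam[NPhi])%E.
  apply: expectation_le.
  - exact: measurable_funM.
  - exact: Lfun_measurable NPhi1.
  - by move=> x; rewrite /= mulr_ge0// ltW.
  - move=> x; apply: le_trans (PhiI x).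
    by rewrite mulr_ge0// ltW.
  - by apply: aeW => x; rewrite /= mulrC.
rewrite expectationZl// expectation_indic// lamI EPhi.
rewrite -(fineK (expectation_fin_num NPhi1)) -EFinM lee_fin => H.
rewrite /= oppr_lt0; apply: lt_le_trans H.
by rewrite mulr_gt0.
Qed.

(** A strict descent from [x] to [y] and a strict ascent from [u] to [v] are confronted with the
    extreme points [p] and [q] of the four. By [T], the values at intermediate points lie between
    [g p] and [g q]. So the descent is impossible when [g p <= g q], and the ascent otherwise. *)
Lemma coherent_monotone :
  (forall x y, 0 < x -> x <= y -> y < 1 -> g x <= g y) \/
  (forall x y, 0 < x -> x <= y -> y < 1 -> g y <= g x).
Proof.
have T a b c : 0 < a -> a <= b -> b <= c -> c < 1 ->
    0 <= (g b - g a) * (g c - g b).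
  move=> a0; rewrite le_eqVlt => /predU1P[<-|ab]; first by rewrite subrr mul0r.
  rewrite le_eqVlt => /predU1P[<-|bc] c1; first by rewrite subrr mulr0.
  exact: coherent_increments.
have [|gN] := pselect (forall x y, 0 < x -> x <= y -> y < 1 -> g x <= g y).
  by left.
right => u v u0 uv v1; rewrite leNgt; apply/negP => guv.
apply: gN => x y x0 xy y1; rewrite leNgt; apply/negP => gyx.
pose p := Num.min x u; pose q := Num.max y v.
have p0 : 0 < p by rewrite lt_min x0.
have q1 : q < 1 by rewrite gt_max y1.
have px : p <= x by rewrite ge_min lexx.
have pu : p <= u by rewrite ge_min lexx orbT.
have yq : y <= q by rewrite le_max lexx.
have vq : v <= q by rewrite le_max lexx orbT.
have H1 := T p x q p0 px (le_trans xy yq) q1.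
have H2 := T p y q p0 (le_trans px xy) yq q1.
have H3 := T p x y p0 px xy y1.
have H4 := T p u q p0 pu (le_trans uv vq) q1.
have H5 := T p v q p0 (le_trans pu uv) vq q1.
have H6 := T p u v p0 pu uv v1.
move: (g p) (g q) (g x) (g y) (g u) (g v) guv gyx H1 H2 H3 H4 H5 H6; clear.
move=> gp gq gx gy gu gv guv gyx H1 H2 H3 H4 H5 H6.
have [pq|qp] := leP gp gq.
- have gxp : gx <= gp.
    move: H3; rewrite -mulrNN pmulr_lge0 ?oppr_gt0 ?subr_lt0//.
    by rewrite oppr_ge0 subr_le0.
  have : gp <= gy by clear -H2 pq; nra.
  lra.
- have gup : gp <= gu.
    by move: H6; rewrite pmulr_lge0 ?subr_gt0// subr_ge0.
  have : gv <= gp by clear -H5 qp; nra.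
  lra.
Qed.

End coherent_monotone.

(** * Quantile functions *)

Lemma measurable_fun_le d (T : measurableType d) (R : realType) (f : T -> R) :
  (forall a, measurable [set t | f t <= a]) -> measurable_fun setT f.
Proof.
move=> mf; apply: (measurability (@RGenOInfty.G R)) => [|_ [_] [r] -> <-].
  exact: RGenOInfty.measurableE.
rewrite setTI (_ : _ @^-1` _ = ~` [set t | f t <= r]); last first.
  by apply/seteqP; split => t /=; rewrite in_itv/= andbT ltNge => /negP.
exact: measurableC.
Qed.

(** * Nondecreasing functions of a uniform variable *)

Section monotone_law.
Context (R : realType).

Local Notation lam :=
  [the probability (measurableTypeR R) R of uniform_prob (@ltr01 R)].

Definition nondecreasing01 (g : R -> R) :=
  forall x y, 0 < x -> x <= y -> y < 1 -> g x <= g y.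

Lemma measurable_itv01 (p : pred R) :
  measurable [set x : measurableTypeR R | p x] ->
  measurable [set x : measurableTypeR R | 0 < x < 1 /\ p x].
Proof.
move=> mp; rewrite (_ : [set _ | _] = `]0, 1[%classic `&` [set x | p x]).
  by apply: measurableI => //; exact: measurable_itv.
by apply/seteqP; split => x /=; rewrite in_itv.
Qed.

(** Sublevel sets of nondecreasing functions are initial segments, so those of [h] and [h'] at one
    level are nested; having equal measure, they differ by a null set. Countably many rational
    levels then separate any two distinct values. *)
Lemma nondecreasing01_same_law_ae (Q : probability (measurableTypeR R) R)
    (f f' : R -> R) : nondecreasing01 f -> nondecreasing01 f' ->
  has_law lam Q f -> has_law lam Q f' -> {ae lam, forall x, f x = f' x}.
Proof.
have half (h h' : R -> R) : nondecreasing01 h -> nondecreasing01 h' ->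
    has_law lam Q h -> has_law lam Q h' -> {ae lam, forall x, h x <= h' x}.
  move=> hnd hnd' [mh hQ] [mh' hQ'].
  have level r : {ae lam, forall x, 0 < x < 1 -> h' x <= r -> h x <= r}.
    pose A : set (measurableTypeR R) := [set x | 0 < x < 1 /\ h x <= r].
    pose A' : set (measurableTypeR R) := [set x | 0 < x < 1 /\ h' x <= r].
    have mA : measurable A.
      by apply: measurable_itv01; exact: (measurable_le r mh).
    have mA' : measurable A'.
      by apply: measurable_itv01; exact: (measurable_le r mh').
    have lamA : lam A = lam A'.
      transitivity (lam [set x | h x <= r]).
        apply: probability_ae => //; first exact: (measurable_le r mh).
        by apply: ae_mono (uniform_itvoo R) => x x01; split => [[]|].
      transitivity (lam [set x | h' x <= r]).
        have mr : measurable [set x : measurableTypeR R | x <= r].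
          exact: (measurable_le r (uniform_id R).1).
        by rewrite (hQ _ mr) -(hQ' _ mr).
      apply: probability_ae => //; first exact: (measurable_le r mh').
      by apply: ae_mono (uniform_itvoo R) => x x01; split => [|[]].
    exists (A' `\` A); split; first exact: measurableD.
      have [A'A|/existsNP[x /not_implyP[[x01 hx'] xA]]] := pselect (A' `<=` A).
        suff -> : A' `\` A = set0 by rewrite measure0.
        by apply/seteqP; split => y // [A'y]; apply; exact: A'A.
      have AA' : A `<=` A'.
        move=> y [y01 hy]; split => //; have [yx|xy] := leP y x.
          apply: le_trans hx'; apply: hnd' => //; first by case/andP: y01.
          by case/andP: x01.
        exfalso; apply: xA; split => //; apply: le_trans hy; apply: hnd.
        - by case/andP: x01.
        - exact: ltW.
        - by case/andP: y01.
      rewrite measureD//; last by rewrite -ge0_fin_numE// fin_num_measure.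
      by rewrite setIidr// [X in (_ - X)%E]lamA subee// fin_num_measure.
    move=> x /= /not_implyP[x01 /not_implyP[hx' hx]]; split => //.
    by move=> [].
  (* An enumeration of the rationals by [nat]; indices that encode no rational give the harmless
     level 0. *)
  pose r n : R := ratr (odflt 0 (unpickle n : option rat)).
  have := ae_foralln (fun n => level (r n)).
  apply: ae_mono2 (uniform_itvoo R) => x x01 H; rewrite leNgt; apply/negP => hh.
  have [q] := rat_in_itvoo hh; rewrite in_itv/= => /andP[h'q qh].
  have := H (pickle q) x01; rewrite /r pickleK/= => /(_ (ltW h'q)).
  by rewrite leNgt qh.
move=> fnd fnd' lf lf'.
apply: ae_mono2 (half _ _ fnd fnd' lf lf') (half _ _ fnd' fnd lf' lf).
move=> x h1 h2.
by apply/eqP; rewrite eq_le h1.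
Qed.

End monotone_law.

Section quantile.
Context (R : realType) (G : cumulativeBounded (0 : R) (1 : R)).

Local Notation lam :=
  [the probability (measurableTypeR R) R of uniform_prob (@ltr01 R)].
Local Notation mu :=
  [the probability (measurableTypeR R) R of lebesgue_stieltjes_measure G].

Lemma lebesgue_stieltjes_le a : mu [set x | x <= a] = (G a)%:E.
Proof.
rewrite -cdf_lebesgue_stieltjes_id /cdf /distribution /pushforward /=.
by congr (lebesgue_stieltjes_measure G _).
Qed.

Lemma cumulative01 a : 0 <= G a <= 1.
Proof.
rewrite -!lee_fin -lebesgue_stieltjes_le measure_ge0 probability_le1//.
exact: (measurable_le a (uniform_id R).1).
Qed.

(** The limits of [G] at both infinities make the infimum that of a nonempty set bounded below, and
    right continuity shows that it is attained ([pinf]). *)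
Lemma quantile_le p x : 0 < p < 1 -> (quantile G p <= x) = (p <= G x).
Proof.
move=> /andP[p0 p1].
have nd : {homo G : x y / x <= y} by exact: cumulative_is_nondecreasing.
have [y0 Gy0] : exists y, G y < p.
  have /cvgrPdist_lt/(_ p p0) := cumulativeNy G.
  move=> [M [_ HM]]; exists (M - 1).
  have M1 : M - 1 < M by rewrite ltrBlDr ltrDl.
  by have := HM _ M1; rewrite sub0r normrN => /(le_lt_trans (ler_norm _)).
have [y1 Gy1] : exists y, p <= G y.
  have p1' : 0 < 1 - p by rewrite subr_gt0.
  have /cvgrPdist_lt/(_ _ p1') := cumulativey G.
  move=> [M [_ HM]]; exists (M + 1).
  have := HM (M + 1); rewrite ltrDl ltr01 => /(_ isT).
  move=> /(le_lt_trans (ler_norm _)).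
  by rewrite ltrD2l ltrN2 => /ltW.
have lbS : has_lbound [set x | p <= G x].
  exists y0 => z /= pz; rewrite leNgt; apply/negP => zy.
  by have := lt_le_trans Gy0 pz; rewrite ltNge (nd _ _ (ltW zy)).
have infS : has_inf [set x | p <= G x] by split => //; exists y1.
have pinf : p <= G (quantile G p).
  rewrite leNgt; apply/negP => Gp.
  have := @cumulative_is_right_continuous _ _ _ G (quantile G p).
  have Gp0 : 0 < p - G (quantile G p) by rewrite subr_gt0.
  move=> /cvgrPdist_lt/(_ _ Gp0).
  rewrite near_withinE => /nbhs_ballP[d /= d0 H].
  have [z /= pz zd] := inf_adherent d0 infS.
  have := H z; rewrite /ball/= => Hz.
  have qz : quantile G p < z.
    rewrite lt_neqAle; apply/andP; split.
      by apply: contraTneq Gp => ->; rewrite -leNgt.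
    exact: (inf_lbound lbS).
  have := Hz _ qz; rewrite distrC gtr0_norm ?subr_gt0// ltrBlDl => /(_ zd).
  rewrite distrC => /(le_lt_trans (ler_norm _)); rewrite ltrD2r ltNge.
  by rewrite pz.
apply/idP/idP => [qx|px]; first exact: le_trans pinf (nd _ _ qx).
exact: (inf_lbound lbS).
Qed.

Lemma quantile_law : has_law lam mu (on01 (quantile G)).
Proof.
have ae_le a : forall x, 0 < x < 1 -> (on01 (quantile G) x <= a) = (x <= G a).
  by move=> x x01; rewrite /on01 patchE mem_set ?quantile_le//= in_itv.
have mid : measurable_fun setT (id : measurableTypeR R -> R).
  exact: (uniform_id R).1.
have mq : measurable_fun setT (on01 (quantile G) : measurableTypeR R -> R).
  apply: measurable_fun_le => a.
  (* Off the open unit interval [on01] is 0, so the sublevel set contains the whole complement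
     exactly when [0 <= a]. *)
  rewrite (_ : [set _ | _] = (`]0, 1[%classic `&` [set x | x <= G a]) `|`
      (~` `]0, 1[%classic `&` [set x | 0 <= a])); last first.
    apply/seteqP; split => x /=; rewrite in_itv/=.
      have [x01|x01] := boolP (0 < x < 1); first by rewrite ae_le//; left.
      rewrite {1}/on01 patchE memNset; last by rewrite /= in_itv/=; exact/negP.
      by right.
    move=> [[x01 xG]|[x01 a0]]; first by rewrite ae_le.
    by rewrite /on01 patchE memNset//= in_itv.
  apply: measurableU; apply: measurableI.
  - exact: measurable_itv.
  - exact: measurable_le.
  - by apply: measurableC; exact: measurable_itv.
  - have [a0|a0] := boolP (0 <= a).
      by rewrite (_ : [set _ | _] = setT)//; apply/seteqP; split.
    by rewrite (_ : [set _ | _] = set0)//; apply/seteqP; split.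
apply: has_law_cdf => // a.
rewrite lebesgue_stieltjes_le -(uniform_le (cumulative01 a)).
apply: probability_ae.
- exact: (measurable_le _ mq).
- exact: (measurable_le _ mid).
- by apply: ae_mono (uniform_itvoo R) => x x01 /=; rewrite ae_le.
Qed.

End quantile.

(** * Left-continuous nondecreasing functions as quantile functions *)

Section monotone_cdf.
Context (R : realType) (g : R -> R).

Local Notation lam :=
  [the probability (measurableTypeR R) R of uniform_prob (@ltr01 R)].

Hypothesis mg : measurable_fun setT (on01 g : measurableTypeR R -> R).
Hypothesis g_left : left_continuous01 g.
Hypothesis g_nd : nondecreasing01 g.

Let g' : {RV lam >-> R} :=
  HB.pack (on01 g : measurableTypeR R -> R)
    (isMeasurableFun.Build _ _ _ _ _ mg).

(** For [G] the distribution function of [g] at a uniform variable, [gG] is the equivalence that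
    also characterizes the quantile function, and it determines the function on the open unit
    interval. *)
Lemma nondecreasing01_quantile :
  exists G : cumulativeBounded (0 : R) (1 : R), on01 (quantile G) = on01 g.
Proof.
pose F r := fine (cdf g' r).
have F_nd : nondecreasing F.
  by move=> *; rewrite fine_le ?fin_num_measure// cdf_nondecreasing.
have F_rc : right_continuous F.
  move=> a; apply: fine_cvg.
  by rewrite fineK ?fin_num_measure//; exact: cdf_right_continuous.
have F_Ny0 : F @ -oo --> (0 : R) by exact/fine_cvg/cvg_cdfNy0.
have F_y1 : F @ +oo --> (1 : R) by exact/fine_cvg/cvg_cdfy1.
have [G GF] : exists G : cumulativeBounded (0 : R) (1 : R), forall x, G x = F x.
  pose G : cumulativeBounded (0 : R) (1 : R) :=
    HB.pack F (isCumulative.Build R _ R F F_nd F_rc)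
      (isCumulativeBounded.Build R 0 1 F F_Ny0 F_y1).
  by exists G.
exists G.
have gE x : 0 < x < 1 -> on01 g x = g x.
  by move=> x01; rewrite /on01 patchE mem_set// in_itv.
have GE x : (G x)%:E = lam [set p | on01 g p <= x].
  rewrite (_ : [set p | on01 g p <= x] = g' @^-1` `]-oo, x]).
    by rewrite GF /F fineK ?fin_num_measure.
  by apply/seteqP; split => p /=; rewrite in_itv.
have mle x := measurable_le x mg.
have mid : measurable_fun setT (id : measurableTypeR R -> R).
  exact: (uniform_id R).1.
have gG p x : 0 < p < 1 -> (g p <= x) = (p <= G x).
  move=> /[dup] p01 /andP[p0 p1]; rewrite -[in RHS]lee_fin GE.
  apply/idP/idP => [gp|].
    rewrite -(uniform_le (a := p)); last by rewrite !ltW.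
    (* The sublevel set is enlarged by a set almost surely contained in it, so that the comparison
       of measures rests on a genuine inclusion. *)
    rewrite (probability_ae (mle x)
      (_ : measurable ([set q | q <= p] `|` [set q | on01 g q <= x]))).
    - apply: le_measure; rewrite ?inE; first exact: (measurable_le _ mid).
        by apply: measurableU; [exact: (measurable_le _ mid)|exact: mle].
      by left.
    - by apply: measurableU; [exact: (measurable_le _ mid)|exact: mle].
    - apply: ae_mono (uniform_itvoo R) => q q01.
      split=> [|[qp|//]]; first by right.
      rewrite /= gE// (le_trans _ gp)//; apply: g_nd => //.
      by case/andP: q01.
  apply: contraTT; rewrite -!ltNge => xgp.
  have e0 : 0 < g p - x by rewrite subr_gt0.
  have /cvgrPdist_lt := g_left p01.
  move=> /(_ _ e0); rewrite near_withinE => /nbhs_ballP[d /= d0 H].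
  (* By left continuity [g] still exceeds [x] at some positive [q < p]; by monotonicity the sublevel
     set then lies below [q], so [G x <= q < p]. *)
  pose q := Num.max (p / 2) (p - d / 2).
  have q0 : 0 < q by rewrite lt_max divr_gt0.
  have qp : q < p by rewrite gt_max; apply/andP; split; lra.
  have pq : p - q < d.
    by rewrite ltrBlDr -ltrBlDl lt_max; apply/orP; right; lra.
  have xq : x < g q.
    have := H q; rewrite /ball/= gtr0_norm ?subr_gt0// => /(_ pq qp).
    by move=> /(le_lt_trans (ler_norm _)); rewrite ltrD2l ltrN2.
  apply: (@le_lt_trans _ _ q%:E); last by rewrite lte_fin.
  rewrite -(uniform_le (a := q)); last by rewrite !ltW// (lt_trans qp).
  rewrite (probability_ae (mle x)
    (_ : measurable ([set y | y <= q] `&` [set q | on01 g q <= x]))).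
  - apply: le_measure; rewrite ?inE; last exact: subIsetl.
      by apply: measurableI; [exact: (measurable_le _ mid)|exact: mle].
    exact: (measurable_le _ mid).
  - by apply: measurableI; [exact: (measurable_le _ mid)|exact: mle].
  - apply: ae_mono (uniform_itvoo R) => y y01; split=> [yx|[]//]; split => //=.
    rewrite leNgt; apply/negP => qy; move: yx.
    rewrite /= gE// leNgt => /negP; apply.
    by rewrite (lt_le_trans xq)// g_nd ?ltW//; case/andP: y01.
apply/funext => p; rewrite /on01 !patchE; case: ifPn => //.
rewrite inE/= in_itv/= => p01.
apply/eqP; rewrite eq_le quantile_le// -gG// lexx/= gG//.
by rewrite -quantile_le.
Qed.

End monotone_cdf.

(** * Characterization of the measures of concordance *)

(** Equality case of Cauchy-Schwarz: [a] is the regression coefficient of [Y] on [X], and the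
    residual has variance 0. *)
Lemma cov_extremal d (T : measurableType d) (R : realType)
    (P : probability T R) (X Y : T -> R) :
  X \in Lfun P 2%:E -> Y \in Lfun P 2%:E -> 0 < cov P X X ->
  cov P X Y ^+ 2 = cov P X X * cov P Y Y ->
  let a := cov P X Y / cov P X X in
  {ae P, forall t, Y t = a * X t + (fine 'E_P[Y]%E - a * fine 'E_P[X]%E)}.
Proof.
move=> X2 Y2 X0 XY a; have aX2 := Lfun2Z a X2; have D2 := Lfun2B Y2 aX2.
have V0 : variance P (Y \- (a \o* X)) = 0%E.
  rewrite /variance cov_finE// (covBl Y2 aX2 D2) (covBr Y2 aX2 Y2).
  rewrite (covBr Y2 aX2 aX2).
  rewrite !(covZr _ X2)// !(covZl _ X2)// (covC P Y X) /a.
  congr (_%:E); apply/(mulIf (lt0r_neq0 X0)); rewrite mul0r.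
  transitivity (cov P X X * cov P Y Y - cov P X Y ^+ 2); last first.
    by rewrite XY subrr.
  by field; exact: lt0r_neq0.
apply: ae_mono (variance0_ae D2 V0) => t /= H.
have -> : Y t = a * X t + (Y t - X t * a) by rewrite mulrC addrC subrK.
rewrite H expectationB ?Lfun2_Lfun1// expectationZl ?Lfun2_Lfun1//.
rewrite fineB ?fin_numM ?expectation_fin_num ?Lfun2_Lfun1//.
by rewrite fineM ?expectation_fin_num ?Lfun2_Lfun1.
Qed.

Section concordance.
Context (R : realType).

Local Notation lam :=
  [the probability (measurableTypeR R) R of uniform_prob (@ltr01 R)].

Lemma comonotonicity_joint_df : joint_df lam id id (comonotonicity R).
Proof.
have mid : measurable_fun setT (id : measurableTypeR R -> R).
  exact: (uniform_id R).1.
split => // u v.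
have minE : (comonotonicity R u v)%:num = Num.min u%:num v%:num.
  by rewrite /= /comonotonicity_fun !minEle -num_le; case: ifP.
rewrite minE -uniform_le; last by rewrite le_min !ge0 ge_min le1.
by congr (lam _); apply/seteqP; split => x /=; rewrite le_min => /andP.
Qed.

Lemma reflect_joint_df :
  exists C : copula R, joint_df lam id (fun x => 1 - x) C.
Proof. exact: uniform_copula (uniform_id R) (uniform_reflect R). Qed.

(** * Sufficiency: correlation of the quantiles of a concordance-inducing [G] *)

Section inducing.
Variable G : cumulativeBounded (0 : R) (1 : R).
Hypothesis G_ind : concordance_inducing G.

Local Notation mu :=
  [the probability (measurableTypeR R) R of lebesgue_stieltjes_measure G].

Let f : measurableTypeR R -> R := on01 (quantile G).
Let m := fine 'E_mu[(fun x : R => x)]%E.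

Let mid : measurable_fun setT (id : measurableTypeR R -> R).
Proof. exact: (uniform_id R).1. Qed.

Lemma inducing_Lfun2 : f \in Lfun lam 2%:E.
Proof.
have [_ G2 _] := G_ind.
apply: (has_law_Lfun2 (quantile_law G) (f := id)).
by apply/Lfun2P; split; [exact: mid|move: G2; rewrite unlock].
Qed.

Lemma inducing_mean : fine 'E_lam[f]%E = m.
Proof. by rewrite /m -(has_law_expectation (quantile_law G) mid). Qed.

Lemma inducing_fin_pos_variance : fin_pos_variance lam f.
Proof.
have [Gc _ _] := G_ind; have f2 := inducing_Lfun2.
split; first exact: Lfun2_Lfun1.
rewrite /variance cov_finE// ltry andbT lte_fin lt_neqAle cov_ge0 andbT.
apply/negP => /eqP V0; have /negP := Gc m; apply.
have := variance0_ae f2; rewrite /variance cov_finE// -V0 => /(_ erefl).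
rewrite inducing_mean => fm.
have mm : measurable [set m : measurableTypeR R] by exact: measurable_set1.
have [mf fE] := quantile_law G.
have := fE _ mm; rewrite -/f => fE'; apply/eqP; rewrite -[LHS]fE'.
rewrite -(@probability_setT _ _ _ lam); apply: probability_ae => //.
  exact: measurable_preimage.
by apply: ae_mono fm => x /= ->.
Qed.

Lemma quantile_nondecreasing01 : nondecreasing01 f.
Proof.
move=> x y x0 xy y1; rewrite /f /on01 !patchE.
have x01 : 0 < x < 1 by rewrite x0 (le_lt_trans xy).
have y01 : 0 < y < 1 by rewrite y1 (lt_le_trans x0).
rewrite !mem_set/= ?in_itv// quantile_le// (le_trans xy)//.
by rewrite -quantile_le.
Qed.

(** Symmetry means that the law is invariant under [2 * m - x]. Reflecting both the argument and the
    value of [f] thus keeps its law and its monotonicity, and [nondecreasing01_same_law_ae]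
    applies. *)
Lemma inducing_reflect : {ae lam, forall x, f (1 - x) = 2 * m - f x}.
Proof.
have [_ _ sym] := G_ind; have lf := quantile_law G.
have f_nd := quantile_nondecreasing01.
have mr : measurable_fun setT (fun x : measurableTypeR R => 2 * m - x).
  by apply: measurable_funB => //; exact: mid.
have sym' : has_law mu mu (fun x => 2 * m - x).
  split => // A mA.
  (* Symmetry is stated for centered variables, so it is used on the translate of [A] by the
     mean. *)
  have mA' : measurable [set x : measurableTypeR R | A (x + m)].
    apply: (measurable_preimage
      (f := fun x : measurableTypeR R => x + m)) => //.
    by apply: measurable_funD => //; exact: mid.
  have := sym _ mA'.
  rewrite (_ : [set x | _] = A); last first.
    by apply/seteqP; split => x /=; rewrite subrK.
  rewrite (_ : [set x | _] = (fun x => 2 * m - x) @^-1` A); first by move/esym.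
  by apply/seteqP; split => x /=; rewrite addrAC -mulr2n mulr_natl.
have lf' : has_law lam mu (fun x => 2 * m - f (1 - x)).
  exact: has_law_comp (uniform_reflect R) (has_law_comp lf sym').
have f'_nd : nondecreasing01 (fun x => 2 * m - f (1 - x)).
  move=> x y x0 xy y1; rewrite lerD2l lerN2; apply: f_nd.
  - by rewrite subr_gt0.
  - by rewrite lerD2l lerN2.
  - by rewrite ltrBlDr ltrDl.
apply: ae_mono (nondecreasing01_same_law_ae f_nd f'_nd lf lf') => x ->.
by rewrite subKr.
Qed.

Lemma inducing_measure_of_concordance :
  measure_of_concordance (rho (quantile G) (quantile G)).
Proof.
have f2 := inducing_Lfun2.
have defG : rho_defined (quantile G) (quantile G).
  by split; exact: inducing_fin_pos_variance.
have V0 : 0 < cov lam f f := fin_pos_variance_cov inducing_fin_pos_variance.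
pose H t : {i01 R} :=
  Itv01 (andP (cumulative01 G t)).1 (andP (cumulative01 G t)).2.
have fG t p : 0 < p < 1 -> (f p <= t) = (p <= (H t)%:num).
  by move=> p01; rewrite /f /on01 patchE mem_set ?quantile_le//= in_itv.
have rhoE' C : rho (quantile G) (quantile G) C = copula_cov f C /
    (Num.sqrt (cov lam f f) * Num.sqrt (cov lam f f)).
  exact: rho_cov defG (law_joint_df C).
split.
- rewrite (rho_cov defG comonotonicity_joint_df) -/f.
  by rewrite -expr2 sqr_sqrtr ?divff ?gt_eqF// ltW.
- move=> d T P U V C C' dfC dfC'.
  by rewrite (rho_cov defG dfC) (rho_cov defG dfC') covC.
- move=> d T P U V C C' dfC dfC'.
  rewrite (rho_cov defG dfC) (rho_cov defG dfC') -mulNr; congr (_ / _).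
  have [lU lV] := joint_df_uniform dfC.
  have fU2 := has_law_Lfun2 lU f2; have fV2 := has_law_Lfun2 lV f2.
  transitivity (cov P (f \o U) (cst (2 * m) \- (f \o V))).
    rewrite /cov; congr fine; apply: covariance_ae.
    + exact: Lfun_measurable fU2.
    + exact: Lfun_measurable fU2.
    + have [_ lV'] := joint_df_uniform dfC'.
      exact: Lfun_measurable (has_law_Lfun2 lV' f2).
    + exact: Lfun_measurable (Lfun2B (Lfun_cst P _ _) fV2).
    + by apply: aeW.
    + exact: (has_law_ae lV inducing_reflect).
  by rewrite covBr ?Lfun_cst// cov_cstr sub0r.
- move=> C C' CC'; rewrite !rhoE' ler_pM2r ?invr_gt0 ?mulr_gt0 ?sqrtr_gt0//.
  exact: copula_cov_le f2 fG _ _ CC'.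
- move=> C_ C CC; rewrite (_ : (fun n => _) = fun n => copula_cov f (C_ n) /
    (Num.sqrt (cov lam f f) * Num.sqrt (cov lam f f))); last exact/funext.
  rewrite rhoE'; apply: cvgM; last exact: cvg_cst.
  exact: copula_cov_cvg f2 fG _ _ CC.
Qed.

End inducing.
End concordance.

(** * Necessity: from a measure of concordance to a distribution function *)

Section necessity.
Context (R : realType).

Local Notation lam :=
  [the probability (measurableTypeR R) R of uniform_prob (@ltr01 R)].

(** Correlation 1 under comonotonicity makes [f2] almost surely equal to [a * f1 + b], and this
    passes to the second margin of any copula, which is uniform. The slope [a] is the ratio of the
    standard deviations, so the normalization absorbs it. *)
Lemma rho_reduce (g1 g2 : R -> R) : rho_defined g1 g2 ->
  rho g1 g2 (comonotonicity R) = 1 -> rho g1 g2 = rho g1 g1.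
Proof.
move=> /[dup] g12 [g1v g2v] r1.
pose f1 : measurableTypeR R -> R := on01 g1.
pose f2 : measurableTypeR R -> R := on01 g2.
have f12 : f1 \in Lfun lam 2%:E := fin_pos_variance_Lfun2 g1v.
have f22 : f2 \in Lfun lam 2%:E := fin_pos_variance_Lfun2 g2v.
have v1 : 0 < cov lam f1 f1 := fin_pos_variance_cov g1v.
have v2 : 0 < cov lam f2 f2 := fin_pos_variance_cov g2v.
pose s1 := Num.sqrt (cov lam f1 f1); pose s2 := Num.sqrt (cov lam f2 f2).
have s10 : 0 < s1 by rewrite sqrtr_gt0.
have s20 : 0 < s2 by rewrite sqrtr_gt0.
have v1E : cov lam f1 f1 = s1 ^+ 2 by rewrite sqr_sqrtr// ltW.
have v2E : cov lam f2 f2 = s2 ^+ 2 by rewrite sqr_sqrtr// ltW.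
have c12 : cov lam f1 f2 = s1 * s2.
  have := r1; rewrite (rho_cov g12 (comonotonicity_joint_df R)) -/s1 -/s2.
  by move/divr1_eq.
have c12' : cov lam f1 f2 ^+ 2 = cov lam f1 f1 * cov lam f2 f2.
  by rewrite c12 v1E v2E exprMn.
pose a := cov lam f1 f2 / cov lam f1 f1.
pose b := fine 'E_lam[f2]%E - a * fine 'E_lam[f1]%E.
have f2E : {ae lam, forall x, f2 x = a * f1 x + b} :=
  cov_extremal f12 f22 v1 c12'.
apply/funext => C; have [lU lV] := joint_df_uniform (law_joint_df C).
rewrite (rho_cov g12 (law_joint_df C)).
rewrite (@rho_cov _ _ _ _ _ _ g1 g1 _ (conj g1v g1v) (law_joint_df C)).
have fU2 := has_law_Lfun2 lU f12; have fV2 := has_law_Lfun2 lV f12.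
have gV2 := has_law_Lfun2 lV f22.
have -> : cov (law C) (on01 g1 \o fst) (on01 g2 \o snd) =
    a * cov (law C) (f1 \o fst) (f1 \o snd).
  rewrite -(cov_affine a b fV2 fU2) /cov; congr fine; apply: covariance_ae.
  - exact: Lfun_measurable fU2.
  - exact: Lfun_measurable fU2.
  - exact: Lfun_measurable gV2.
  - apply: measurable_funD => //; apply: measurable_funM => //.
    exact: Lfun_measurable fV2.
  - by apply: aeW.
  - apply: ae_mono (has_law_ae lV f2E) => w f2w.
    by rewrite /= mulrC; exact: f2w.
rewrite -/f1 -/f2 -/s1 -/s2 /a c12 v1E; field.
by rewrite !gt_eqF.
Qed.

(** Positive variance excludes a point mass. Antisymmetry at the comonotonicity copula gives
    correlation -1 between [f] and its reflection, hence an affine relation of slope -1 by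
    [cov_extremal], which is the symmetry of the law. *)
Lemma measure_of_concordance_inducing (g : R -> R)
    (G : cumulativeBounded (0 : R) (1 : R)) :
  rho_defined g g -> measure_of_concordance (rho g g) ->
  on01 (quantile G) = on01 g -> concordance_inducing G.
Proof.
move=> gdef [_ _ anti _ _] qg; have gv := gdef.1.
pose f : measurableTypeR R -> R := on01 g.
have f2 : f \in Lfun lam 2%:E := fin_pos_variance_Lfun2 gv.
have v0 : 0 < cov lam f f := fin_pos_variance_cov gv.
have mf := Lfun_measurable f2.
have mid : measurable_fun setT (id : measurableTypeR R -> R).
  exact: (uniform_id R).1.
have := quantile_law G; rewrite qg -/f => lf; have [_ lfE] := lf.
have meanE : fine ('E_(lebesgue_stieltjes_measure G)[(fun x : R => x)])%E =
    fine 'E_lam[f]%E.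
  by rewrite -(has_law_expectation lf mid).
have f_refl : {ae lam, forall x, f (1 - x) = 2 * fine 'E_lam[f]%E - f x}.
  have [C dfC] := reflect_joint_df R; have lr := uniform_reflect R.
  have fr2 := has_law_Lfun2 lr f2.
  have frE : cov lam (f \o (fun x => 1 - x)) (f \o (fun x => 1 - x)) =
      cov lam f f.
    by rewrite /cov (has_law_covariance lr).
  have cE : cov lam f (f \o (fun x => 1 - x)) = - cov lam f f.
    have := anti _ _ _ _ _ _ _ (comonotonicity_joint_df R) dfC.
    rewrite (rho_cov gdef dfC) (rho_cov gdef (comonotonicity_joint_df R)).
    rewrite -mulNr.
    by apply: mulIf; rewrite invr_eq0 mulf_neq0// gt_eqF// sqrtr_gt0.
  have := cov_extremal f2 fr2 v0; rewrite cE sqrrN frE expr2 => /(_ erefl).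
  apply: ae_mono => x /= ->.
  rewrite (has_law_expectation lr mf) mulNr divff ?gt_eqF// !mulN1r opprK.
  by rewrite addrC mulr_natl mulr2n.
split.
- move=> c; apply/negP => /eqP c1.
  have fc : {ae lam, forall x, f x = cst c x}.
    have mc : measurable (f @^-1` [set c]).
      by apply: measurable_preimage => //; exact: measurable_set1.
    exists (~` (f @^-1` [set c])); split => //; first exact: measurableC.
    rewrite probability_setC// lfE; last exact: measurable_set1.
    by rewrite [X in (_ - X)%E]c1 subee.
  suff : cov lam f f = 0 by move=> fv; rewrite fv ltxx in v0.
  rewrite /cov (covariance_ae mf (measurable_cst c) mf mf fc).
    by rewrite covariance_cst_l.
  exact: aeW.
- have /Lfun2P[_] := f2; rewrite unlock.
  rewrite -(has_law_ge0_integral lf (f := fun x => (x ^+ 2)%:E))//.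
  + by apply/measurable_EFinP; apply: measurable_funX; exact: mid.
  + by move=> x; rewrite lee_fin sqr_ge0.
- move=> A mA; set m := fine _.
  have mE : m = fine 'E_lam[f]%E := meanE.
  clearbody m.
  have mA1 : measurable [set x : measurableTypeR R | A (x - m)].
    apply: (measurable_preimage
      (f := fun x : measurableTypeR R => x - m)) => //.
    by apply: measurable_funB => //; exact: mid.
  have mA2 : measurable [set x : measurableTypeR R | A (m - x)].
    apply: (measurable_preimage
      (f := fun x : measurableTypeR R => m - x)) => //.
    by apply: measurable_funB => //; exact: mid.
  have [mr rE] := uniform_reflect R.
  have mfA1 := measurable_preimage mf mA1.
  have mfA2 := measurable_preimage mf mA2.
  (* The right-hand event is reflected in the unit interval, after which [f_refl] turns
     [m - f (1 - x)] into [f x - m]. *)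
  rewrite -[LHS](lfE _ mA1) -[RHS](lfE _ mA2) -[RHS](rE _ mfA2).
  apply: probability_ae => //; first exact: measurable_preimage.
  apply: ae_mono f_refl => x /= ->.
  by rewrite mE opprB addrCA mulr_natl mulr2n opprD addNKr.
Qed.

Lemma measure_of_concordance_nondecreasing (g : R -> R) :
  rho_defined g g -> measure_of_concordance (rho g g) ->
  left_continuous01 g -> nondecreasing01 g ->
  exists G : cumulativeBounded (0 : R) (1 : R),
    concordance_inducing G /\ rho g g = rho (quantile G) (quantile G).
Proof.
move=> gdef gmc g_left g_nd.
have mg : measurable_fun setT (on01 g : measurableTypeR R -> R).
  exact: Lfun_measurable (fin_pos_variance_Lfun2 gdef.1).
have [G qg] := nondecreasing01_quantile mg g_left g_nd.
exists G; split; first exact: measure_of_concordance_inducing gdef gmc qg.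
by rewrite /rho qg.
Qed.

Lemma on01N (g : R -> R) : on01 (\- g) = \- on01 g.
Proof.
by apply/funext => x; rewrite /on01 /= !patchE; case: ifP => //; rewrite oppr0.
Qed.

Lemma rho_definedN (g : R -> R) : rho_defined g g -> rho_defined (\- g) (\- g).
Proof.
suff H : fin_pos_variance lam (on01 g) -> fin_pos_variance lam (on01 (\- g)).
  by move=> [g1 g2]; split; exact: H.
move=> gv; have g2 := fin_pos_variance_Lfun2 gv; have [g1 V] := gv.
by rewrite on01N; split; [rewrite rpredN|rewrite varianceN].
Qed.

Lemma rhoNN (g : R -> R) : rho_defined g g -> rho (\- g) (\- g) = rho g g.
Proof.
move=> gdef; apply/funext => C; have g2 := fin_pos_variance_Lfun2 gdef.1.
have [lU lV] := joint_df_uniform (law_joint_df C).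
have gU2 := has_law_Lfun2 lU g2; have gV2 := has_law_Lfun2 lV g2.
rewrite (rho_cov gdef (law_joint_df C)).
rewrite (rho_cov (rho_definedN gdef) (law_joint_df C)) on01N.
have NN d (T : measurableType d) (P : probability T R) (X Y : T -> R) :
    X \in Lfun P 2%:E -> Y \in Lfun P 2%:E -> cov P (\- X) (\- Y) = cov P X Y.
  by move=> X2 Y2; rewrite covNl ?Lfun2N// covC covNl// opprK covC.
by rewrite (NN _ _ _ _ _ g2 g2) (NN _ _ _ _ _ gU2 gV2).
Qed.

End necessity.

Theorem theorem2 (R : realType) (g1 g2 : R -> R)
    (g1_left : left_continuous01 g1) (g2_left : left_continuous01 g2)
    (g1_discrete : discrete_set (discontinuities01 g1))
    (g2_discrete : discrete_set (discontinuities01 g2)) :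
  (rho_defined g1 g2 /\ measure_of_concordance (rho g1 g2)) <->
  (exists G : cumulativeBounded (0 : R) (1 : R),
     [/\ concordance_inducing G, rho_defined g1 g2 &
         rho g1 g2 = rho (quantile G) (quantile G)]).
Proof.
split=> [[g12 mc]|[G [Gi g12 ->]]]; last first.
  by split => //; exact: inducing_measure_of_concordance.
have r1 : rho g1 g2 (comonotonicity R) = 1 by case: mc.
have r12 := rho_reduce g12 r1; rewrite r12 in mc *.
have g11 : rho_defined g1 g1 := conj g12.1 g12.1.
have coh : coherent (rho g1 g1) by case: mc.
have [g_nd|g_ni] := coherent_monotone g11 g1_left coh.
  have [G [? ?]] := measure_of_concordance_nondecreasing g11 mc g1_left g_nd.
  by exists G.
(* A nonincreasing [g1] is replaced by its opposite, which has the same [rho] because the two sign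
   changes cancel. *)
have Nleft : left_continuous01 (\- g1).
  by move=> x x01; apply: cvgN; exact: g1_left.
have N_nd : nondecreasing01 (\- g1).
  by move=> x y x0 xy y1; rewrite lerN2; exact: g_ni.
have rN := rhoNN g11; rewrite -rN in mc *.
have [G [? ?]] :=
  measure_of_concordance_nondecreasing (rho_definedN g11) mc Nleft N_nd.
by exists G.
Qed.
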